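(* For every integer $k\ge1$, $$\gamma(\mathbb U)\ge\gamma(S_{2k})\ge\gamma(S_2)\ge 2-\frac{2}{\sqrt e}.$$ If $k\ge3$ is odd, then $\gamma(S_k)\ge(1+\delta_k)\big(1-e^{-1/(1+\delta_k)}\big)$, where $\delta_k=\cos(\pi/k)$.
   Context: $\mathbb U=\{z\in\mathbb C:|z|\le1\}$. For $S\subseteq\mathbb U$, $\mathcal F(S)$ is the class of completely multiplicative $f:\mathbb N\to\mathbb C$ with $f(p)\in S$ for every prime $p$; $S_k=\{0\}\cup\{\xi:\xi^k=1\}$. For $A\ge1$, $\varepsilon>0$, $f$ satisfies $C(\varepsilon,X,A)$ if $|\sum_{n\le x}f(n)|\le\varepsilon x$ for all $X\le x\le X^A$. Define $\gamma(S;A)=\lim_{\varepsilon\to0^+}\limsup_{X\to\infty}\sup\{\frac1{\log X}|\sum_{n\le X}f(n)/n| : f\in\mathcal F(S)\text{ satisfies }C(\varepsilon,X,A)\}$ (empty supremum $=0$), and $\gamma(S)=\lim_{A\to\infty}\gamma(S;A)$. *)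

(* Defs.v *)
From HB Require Import structures.
From mathcomp Require Import all_boot all_order all_algebra.
From mathcomp Require Import complex.
From mathcomp Require Import all_classical all_reals all_analysis.

Set Implicit Arguments.
Unset Strict Implicit.
Unset Printing Implicit Defensive.

Import Order.TTheory GRing.Theory Num.Theory.
Import numFieldNormedType.Exports.

Local Open Scope classical_set_scope.
Local Open Scope ring_scope.
Local Open Scope complex_scope.

Section Definitions.
Variable R : realType.
Implicit Types (S : set R[i]) (f : nat -> R[i]) (eps X A x : R).

(* The modulus as an element of R: `|z| itself lives in R[i]. *)
Local Notation cmod := (@ComplexField.Normc.normc R).

Definition unit_disc : set R[i] := [set z | cmod z <= 1].

Definition roots0 (k : nat) : set R[i] := [set 0] `|` [set xi | xi ^+ k = 1].

(* Arithmetic functions have domain {1, 2, ...}; the value f 0 is junk. *)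
Definition completely_multiplicative f : Prop :=
  f 1%N = 1 /\
  forall m n : nat, (0 < m)%N -> (0 < n)%N -> f (m * n)%N = f m * f n.

Definition mult_class S : set (nat -> R[i]) :=
  [set f | completely_multiplicative f /\ forall p : nat, prime p -> S (f p)].

Definition sum_upto (g : nat -> R[i]) x : R[i] :=
  \sum_(1 <= n < (Num.truncn x).+1) g n.

Definition small_means eps X A f : Prop :=
  forall x, X <= x -> x <= X `^ A -> cmod (sum_upto f x) <= eps * x.

Definition log_mean f X : R :=
  (ln X)^-1 * cmod (sum_upto (fun n => f n / n%:R) X).

Definition log_means S eps X A : set \bar R :=
  [set (log_mean f X)%:E | f in [set f | mult_class S f /\ small_means eps X A f]].

(* ereal_sup set0 is -oo, whereas here the empty supremum is 0. *)
Definition esup_or0 (E : set \bar R) : \bar R :=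
  if E == set0 then 0%E else ereal_sup E.

(* Both limits exist in \bar R: the limsup is nondecreasing in eps, and gammaA
   is nonincreasing in A; so lim takes no default value here. *)
Definition gammaA S A : \bar R :=
  lim (limf_esup (fun X => esup_or0 (log_means S eps X A)) (pinfty_nbhs R)
       @[eps --> 0^'+]).

Definition gamma S : \bar R := lim (gammaA S A @[A --> +oo]).

Definition delta (k : nat) : R := cos (pi / k%:R).

End Definitions.

Arguments unit_disc R : clear implicits.
Arguments roots0 R k : clear implicits.
Arguments delta R k : clear implicits.

(* Main.v *)
Require Import Defs.
From HB Require Import structures.
From mathcomp Require Import all_boot all_order all_algebra.
From mathcomp Require Import zify lra ring.
From mathcomp Require Import complex.
From mathcomp Require Import all_classical all_reals all_analysis.

Import Order.TTheory GRing.Theory Num.Theory.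
Import numFieldNormedType.Exports.

Set Implicit Arguments.
Unset Strict Implicit.
Unset Printing Implicit Defensive.

Local Open Scope ring_scope.

(** Let [xi] be a unimodular number with [c := 1 - Re xi] between [3/2] and [2],
    and [u := exp (1/c) < 2].  Put [f p = 1] for [p <= y], [f p] in
    [{xi, conj xi}], with balanced signs, for [y < p <= X := y^u], and write
    [f = 1 * g].  As [g] lives on integers free of primes up to [y], the mean
    value of [f] up to [x] is [G x := sum_(d <= x) g d / d] up to [O (1 / ln y)],
    so only Mertens' theorems on the primes are needed.  For [x <= X] one finds
    [G x = 1 - c ln (ln x / ln y)], which vanishes at [X] and has logarithmic
    average [c (1 - exp (- 1/c))] there.  Differentiating logarithmically,
    [G] stays at [0] beyond [X] as soon as
    [T z := sum_(q <= z) Lambda q (1 - f q) / q] satisfies the renewal equation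
    [T z = T X + sum_(y < q <= X) (c/q) T (z/q)] up to [O(1)].  Its right-hand
    side is an average of earlier values of [T], hence never grows faster than
    [T] can, and a greedy choice of [f p] in [{1, xi, conj xi}] for the primes
    [p > X] follows it.  The bounds come from [xi = -1] ([c = 2]) and
    [xi = - exp (i pi/k)] ([c = 1 + delta_k]). *)

(** * The von Mangoldt function *)

Section Mangoldt.
Variable R : realType.
Implicit Types (m n p q j N : nat) (F : nat -> R).

(** The logarithmic mean at [X] depends only on the primes up to [X]; those beyond serve to keep the
    means small up to [X^A]. Put [L z := sum_(n <= z) g n ln n / n = - sum_m (g m / m) T (z/m)]. For
    [z >= X] the renewal equation balances the terms [m = 1] and [y < m <= X] against [L X], while
    the terms [m > X] involve only values of [G] between [X] and [z/y]. Partial summation from [L]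
    back to [G] then gives an induction over the ranges [z < X y^j]: each step multiplies the error
    by a factor depending only on [B], where [X^A <= y^B], and the initial error is [O(1 / ln y)].
    For fixed [A] it tends to [0] as [y] grows. The condition [u < 2] makes a product of two primes
    above [y] exceed [X], so that between [y] and [X] the function [g] lives on primes and [G] is
    linear in the values [f p]. It means [1/c < ln 2], which [c >= 3/2] guarantees; for odd [k] the
    latter is [cos (pi/k) >= 1/2]. For odd [k] the number [-1] is not a [k]-th root of unity; the
    substitute has an imaginary part, which the signs cancel. Since [f p] ranges over a finite set,
    [T] can follow the renewal equation only up to [O(1)], which the factor [1 / ln y] absorbs. *)

Definition vonMangoldt n : R := if primes n is [:: p] then ln p%:R else 0.

Local Notation Lambda := vonMangoldt.

Lemma primes_eq1P p q : prime p ->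
  reflect (exists2 j, (0 < j)%N & q = (p ^ j)%N) (primes q == [:: p]).
Proof.
move=> pp; apply: (iffP eqP) => [qp | [[//|j] _ ->]]; last first.
  by rewrite primesX // primes_prime.
have q0 : (0 < q)%N by case: q qp.
exists (logn p q); first by rewrite logn_gt0 qp inE.
rewrite -p_part part_pnat_id //; apply/pnatP => // r pr rq; apply/eqP.
have : r \in primes q by rewrite mem_primes pr q0.
by rewrite qp inE => /eqP ->.
Qed.

Lemma vonMangoldt_prime p : prime p -> Lambda p = ln p%:R.
Proof. by move=> pp; rewrite /Lambda primes_prime. Qed.

Lemma vonMangoldt_ge0 n : 0 <= Lambda n.
Proof.
rewrite /Lambda; case E: (primes n) => [|p [|? ?]] //; apply: ln_ge0.
have : p \in primes n by rewrite E inE.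
by rewrite mem_primes ler1n => /andP[/prime_gt0].
Qed.

(** Only prime powers contribute, and they are grouped by their base. The weight [F] is general
    because the lemma serves twice: with [F = 1] for [ln = 1 * Lambda], and with a weight on
    nonprimes to bound the higher prime powers. *)
Lemma sum_divisors_vonMangoldt F n : (0 < n)%N ->
  \sum_(q <- divisors n) Lambda q * F q =
  \sum_(p <- primes n) \sum_(1 <= j < (logn p n).+1) ln p%:R * F (p ^ j)%N.
Proof.
move=> n0.
transitivity (\sum_(q <- divisors n) \sum_(p <- primes n)
    if primes q == [:: p] then ln p%:R * F q else 0).
  apply: eq_big_seq => q; rewrite -dvdn_divisors // => qn.
  rewrite /Lambda; case E: (primes q) => [|p [|p' s]].
  - by rewrite mul0r big1.
  - have pn : p \in primes n.
      have : p \in primes q by rewrite E inE.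
      rewrite !mem_primes n0 => /and3P[-> _ pq] /=; exact: dvdn_trans qn.
    rewrite (big_rem _ pn) /= eqxx big1_seq ?addr0 // => r /andP[_ rr].
    case: eqP => // -[pr]; move: rr.
    by rewrite -pr mem_rem_uniq ?primes_uniq // inE eqxx.
  - rewrite mul0r big1 // => r _.
    by rewrite eqseq_cons andbF.
rewrite exchange_big /=; apply: eq_big_seq => p.
rewrite mem_primes => /and3P[pp _ pn].
rewrite -big_mkcond /= -big_filter.
rewrite (perm_big [seq (p ^ j)%N | j <- index_iota 1 (logn p n).+1]) ?big_map //=.
apply: uniq_perm.
- by rewrite filter_uniq // divisors_uniq.
- rewrite map_inj_in_uniq ?iota_uniq // => i j _ _ /eqP.
  by rewrite eqn_exp2l ?prime_gt1 // => /eqP.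
move=> q; rewrite mem_filter -dvdn_divisors //; apply/andP/mapP.
  move=> [/primes_eq1P -/(_ pp)[j j0 ->]] ; rewrite pfactor_dvdn // => jn.
  by exists j => //; rewrite mem_index_iota j0 ltnS.
move=> [j]; rewrite mem_index_iota ltnS => /andP[j0 jn] ->.
by split; [apply/primes_eq1P => //; exists j | rewrite pfactor_dvdn].
Qed.

Lemma ln_sum_vonMangoldt n : (0 < n)%N -> \sum_(q <- divisors n) Lambda q = ln n%:R.
Proof.
move=> n0; have := sum_divisors_vonMangoldt (fun=> 1) n0.
under eq_bigr do rewrite mulr1.
move=> ->; rewrite [in RHS](prod_prime_decomp n0) prime_decompE big_map /=.
have : all (fun p => 0 < p)%N (primes n).
  by apply/allP => p; rewrite mem_primes => /andP[/prime_gt0].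
elim: (primes n) => [|p s IH] /=; first by rewrite !big_nil ln1.
move=> /andP[p0 s0]; rewrite !big_cons IH // natrM lnM ?posrE ?ltr0n.
- rewrite natrX lnXn ?ltr0n //; congr (_ + _).
  under eq_bigr do rewrite mulr1.
  by rewrite big_const_nat subn1 iter_addr addr0.
- by rewrite expn_gt0 p0.
- rewrite big_seq; apply: prodn_cond_gt0 => q qs.
  by rewrite expn_gt0 (allP s0).
Qed.

End Mangoldt.

(** * Dirichlet convolution *)

Section Dirichlet.
Variable V : nmodType.
Implicit Types (d e k m n N : nat).

Lemma big_divisors (F : nat -> V) n N : (0 < n <= N)%N ->
  \sum_(d <- divisors n) F d = \sum_(1 <= d < N.+1 | (d %| n)%N) F d.
Proof.
move=> /andP[n0 nN]; rewrite -[RHS]big_filter; apply: perm_big; apply: uniq_perm.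
- exact: divisors_uniq.
- by rewrite filter_uniq // iota_uniq.
move=> d; rewrite mem_filter -dvdn_divisors // mem_index_iota.
case: (boolP (d %| n)%N) => //= dn; have := dvdn_leq n0 dn.
by have := dvdn_gt0 n0 dn; lia.
Qed.

Lemma sum_divisors_exchange (H : nat -> nat -> V) N :
  \sum_(1 <= n < N.+1) \sum_(d <- divisors n) H d (n %/ d)%N =
  \sum_(1 <= d < N.+1) \sum_(1 <= m < (N %/ d).+1) H d m.
Proof.
transitivity (\sum_(1 <= n < N.+1) \sum_(1 <= d < N.+1 | (d %| n)%N) H d (n %/ d)%N).
  by apply: eq_big_nat => n nN; rewrite (@big_divisors _ _ N).
rewrite (exchange_big_dep predT) //=; apply: eq_big_nat => d /andP[d0 dN].
rewrite -big_filter.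
rewrite (perm_big [seq (d * m)%N | m <- index_iota 1 (N %/ d).+1]); last first.
  apply: uniq_perm.
  - by rewrite filter_uniq // iota_uniq.
  - rewrite map_inj_in_uniq ?iota_uniq // => i j _ _ /eqP.
    by rewrite eqn_pmul2l // => /eqP.
  move=> n; rewrite mem_filter mem_index_iota; apply/andP/mapP.
    move=> [/dvdnP[m ->] mN]; exists m; last by rewrite mulnC.
    rewrite mem_index_iota !ltnS leq_divRL //.
    by move: mN; rewrite muln_gt0 d0 andbT ltnS.
  move=> [m]; rewrite mem_index_iota ltnS leq_divRL // => /andP[m0 mN] ->.
  by rewrite dvdn_mulr // muln_gt0 d0 m0 ltnS mulnC.
by rewrite big_map; apply: eq_big_nat => m _; rewrite mulKn.
Qed.

Lemma sum_divisorsC (H : nat -> nat -> V) n : (0 < n)%N ->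
  \sum_(d <- divisors n) H d (n %/ d)%N = \sum_(d <- divisors n) H (n %/ d)%N d.
Proof.
move=> n0; rewrite (perm_big [seq (n %/ d)%N | d <- divisors n]) ?big_map.
  rewrite !big_seq; apply: eq_bigr => d; rewrite -dvdn_divisors // => dn.
  by rewrite divnA // mulKn.
have inv d : (d %| n)%N -> (n %/ (n %/ d))%N = d by move=> dn; rewrite divnA // mulKn.
apply: uniq_perm.
- exact: divisors_uniq.
- rewrite map_inj_in_uniq ?divisors_uniq // => i j.
  by rewrite -!dvdn_divisors // => /inv {2}<- /inv {2}<- ->.
move=> d; apply/idP/mapP => [|[e]]; rewrite -!dvdn_divisors //.
  by move=> dn; exists (n %/ d)%N; rewrite -?dvdn_divisors ?dvdn_div ?inv.
by move=> en ->; rewrite dvdn_div.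
Qed.

Lemma sum_hyperbolaC (H : nat -> nat -> V) N :
  \sum_(1 <= d < N.+1) \sum_(1 <= m < (N %/ d).+1) H d m =
  \sum_(1 <= m < N.+1) \sum_(1 <= d < (N %/ m).+1) H d m.
Proof.
rewrite -sum_divisors_exchange -(sum_divisors_exchange (fun m d => H d m)).
by apply: eq_big_nat => n /andP[n0 _]; rewrite sum_divisorsC.
Qed.

(** Associativity of Dirichlet convolution, for an arbitrary function of the three factors. *)
Lemma sum_divisorsA (H : nat -> nat -> nat -> V) n : (0 < n)%N ->
  \sum_(d <- divisors n) \sum_(e <- divisors d) H e (d %/ e)%N (n %/ d)%N =
  \sum_(e <- divisors n) \sum_(k <- divisors (n %/ e)) H e k (n %/ e %/ k)%N.
Proof.
move=> n0.
transitivity (\sum_(d <- divisors n) \sum_(e <- divisors n | (e %| d)%N)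
    H e (d %/ e)%N (n %/ d)%N).
  rewrite !big_seq; apply: eq_bigr => d; rewrite -dvdn_divisors // => dn.
  have d0 := dvdn_gt0 n0 dn.
  have d_n : (0 < d <= n)%N by rewrite d0 dvdn_leq.
  rewrite (big_divisors _ d_n) -[RHS]big_filter -[LHS]big_filter.
  apply: perm_big; apply: uniq_perm.
  - by rewrite filter_uniq // iota_uniq.
  - by rewrite filter_uniq // divisors_uniq.
  move=> e; rewrite !mem_filter mem_index_iota -dvdn_divisors //.
  case: (boolP (e %| d)%N) => //= ed.
  have en := dvdn_trans ed dn; rewrite en (dvdn_gt0 n0 en) ltnS.
  by rewrite dvdn_leq.
rewrite (exchange_big_dep predT) //= !big_seq; apply: eq_bigr => e.
rewrite -dvdn_divisors // => en; have e0 := dvdn_gt0 n0 en.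
have ne0 : (0 < n %/ e)%N by rewrite divn_gt0 // dvdn_leq.
rewrite -big_filter (perm_big [seq (e * k)%N | k <- divisors (n %/ e)%N]).
  by rewrite big_map; apply: eq_bigr => k _; rewrite mulKn // divnMA.
apply: uniq_perm.
- by rewrite filter_uniq // divisors_uniq.
- rewrite map_inj_in_uniq ?divisors_uniq // => i j _ _ /eqP.
  by rewrite eqn_pmul2l // => /eqP.
move=> d; rewrite mem_filter -dvdn_divisors //; apply/andP/mapP.
  move=> [/dvdnP[k ->] kn]; exists k; last by rewrite mulnC.
  by rewrite -dvdn_divisors // dvdn_divRL.
move=> [k]; rewrite -dvdn_divisors // dvdn_divRL // mulnC => kn ->.
by rewrite dvdn_mulr.
Qed.

End Dirichlet.

Lemma divn_dvd_gt0 d n : (0 < n)%N -> (d %| n)%N -> (0 < n %/ d)%N.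
Proof. by move=> n0 dn; rewrite divn_gt0 ?(dvdn_gt0 n0 dn) // (dvdn_leq n0 dn). Qed.

(** * Quotient of an arithmetic function by the constant 1, and its logarithmic derivative *)

Section MoebiusFactor.
Variable R : realType.
Local Notation C := R[i].
Local Notation "x %:C" := (real_complex R x).
Local Notation Lambda := (@vonMangoldt R).
Local Notation lnn n := (ln (n%:R : R)).
Implicit Types (f a b : nat -> C) (d e k m n N : nat).

(** Recursion on all earlier values. The step [D] receives a total function, equal to [e] below [n]
    and to [b0] from [n] on, so each use has to check what [D] reads. It yields the quotient [g],
    the signs and the greedy selection. *)
Lemma course_of_values (B : Type) (b0 : B) (D : (nat -> B) -> nat -> B) :
  exists e : nat -> B,
    forall n, e n = D (fun m => if (m < n)%N then e m else b0) n.
Proof.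
(* [h n] tabulates the first [n] values and is [b0] elsewhere. *)
pose fix h n : nat -> B := if n is n'.+1 then
  fun m => if m == n' then D (h n') n' else h n' m else fun=> b0.
have hE n m : h n m = if (m < n)%N then h m.+1 m else b0.
  elim: n => [//|n IH]; rewrite ltnS leq_eqVlt; case: (eqVneq m n) => [->//|mn].
  by rewrite /= (negPf mn) IH.
exists (fun n => h n.+1 n) => n; rewrite [LHS]/= eqxx; congr (D _ n).
by apply/funext => m; rewrite hE.
Qed.

Lemma ex_dirichlet_quotient f : exists g : nat -> C,
  forall n, (0 < n)%N -> \sum_(d <- divisors n) g d = f n.
Proof.
(* Moebius inversion by recursion: the equation is solved for its term [d = n]. Inside the recursion
   this term reads the default [0], which leaves the proper divisors. *)
have [g gE] := course_of_values 0
  (fun (g : nat -> C) n => f n - \sum_(1 <= d < n.+1 | (d %| n)%N) g d).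
exists g => n n0; rewrite (@big_divisors _ _ _ n) ?n0 /= ?leqnn //.
rewrite big_mkcond big_nat_recr //= dvdnn [X in _ + X]gE.
rewrite [X in _ - X]big_mkcond big_nat_recr //= dvdnn ltnn addr0.
rewrite [X in _ - X](_ : _ = \sum_(1 <= d < n) if (d %| n)%N then g d else 0).
  by rewrite addrCA subrr addr0.
by apply: eq_big_nat => d /andP[_ ->].
Qed.

Lemma sum_divisors_inj a b :
  (forall n, (0 < n)%N -> \sum_(d <- divisors n) a d = \sum_(d <- divisors n) b d) ->
  forall n, (0 < n)%N -> a n = b n.
Proof.
move=> H; elim/ltn_ind => n IH n0; have := H n n0.
rewrite !(@big_divisors _ _ _ n) ?n0 /= ?leqnn //.
rewrite !(big_mkcond (fun d => d %| n)%N) !big_nat_recr //= dvdnn.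
rewrite [X in X + _](_ : _ = \sum_(1 <= d < n) if (d %| n)%N then b d else 0).
  by move/addrI.
by apply: eq_big_nat => d /andP[d0 dn]; rewrite IH.
Qed.

(* Logarithmic differentiation: [f log = f * f Lambda] and [log = 1 * Lambda],
   and multiplication by [log] is a derivation for Dirichlet convolution. *)
Lemma dirichlet_quotient_ln f (g : nat -> C) :
  completely_multiplicative f ->
  (forall n, (0 < n)%N -> \sum_(d <- divisors n) g d = f n) ->
  forall n, (0 < n)%N ->
  g n * (lnn n)%:C =
  \sum_(d <- divisors n) g d * ((Lambda (n %/ d))%:C * (f (n %/ d)%N - 1)).
Proof.
move=> [f1 fM] gE.
apply: sum_divisors_inj => n n0.
have lnD d : (d %| n)%N -> lnn n = lnn d + lnn (n %/ d).
  move=> dn; have d0 := dvdn_gt0 n0 dn.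
  rewrite -lnM ?posrE ?ltr0n ?divn_dvd_gt0 // -natrM.
  by rewrite mulnC divnK.
(* Both sides are compared after convolution with [1], where the derivation rule reads
   [1 * (g log) = f log - g * log]. *)
have E1 : \sum_(d <- divisors n) g d * (lnn d)%:C =
    f n * (lnn n)%:C - \sum_(d <- divisors n) g d * (lnn (n %/ d))%:C.
  rewrite -(gE n n0) mulr_suml -sumrB [LHS]big_seq [RHS]big_seq.
  apply: eq_bigr => d; rewrite -dvdn_divisors // => dn.
  by rewrite (lnD d dn) rmorphD /= mulrDr addrK.
have E2 : \sum_(d <- divisors n) g d * (lnn (n %/ d))%:C =
    \sum_(d <- divisors n) \sum_(e <- divisors d) g e * (Lambda (d %/ e))%:C.
  have -> := @sum_divisorsA _ (fun e k l => g e * (Lambda k)%:C) n n0.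
  rewrite !big_seq; apply: eq_bigr => d; rewrite -dvdn_divisors // => dn.
  rewrite -mulr_sumr -rmorph_sum /= ln_sum_vonMangoldt //.
  exact: divn_dvd_gt0.
have E3 : f n * (lnn n)%:C =
    \sum_(d <- divisors n) \sum_(e <- divisors d) g e * ((Lambda (d %/ e))%:C * f (d %/ e)%N).
  have -> := @sum_divisorsA _ (fun e k l => g e * ((Lambda k)%:C * f k)) n n0.
  transitivity (\sum_(e <- divisors n) \sum_(k <- divisors (n %/ e))
      g e * ((Lambda (n %/ e %/ k))%:C * f (n %/ e %/ k)%N)).
    rewrite -(@sum_divisorsA _ (fun e k l => g e * ((Lambda l)%:C * f l)) n n0).
    rewrite -ln_sum_vonMangoldt // rmorph_sum /= mulr_sumr.
    rewrite (@sum_divisorsC _ (fun d e => f n * (Lambda d)%:C) n n0) /=.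
    rewrite !big_seq; apply: eq_bigr => d; rewrite -dvdn_divisors // => dn.
    have d0 := dvdn_gt0 n0 dn; rewrite -mulr_suml gE //.
    rewrite mulrCA -fM ?divn_dvd_gt0 // mulnC divnK //.
    by rewrite mulrC.
  rewrite !big_seq; apply: eq_bigr => d; rewrite -dvdn_divisors // => dn.
  have d0 := dvdn_gt0 n0 dn.
  have nd0 : (0 < n %/ d)%N by exact: divn_dvd_gt0.
  by rewrite (@sum_divisorsC _ (fun k l => g d * ((Lambda l)%:C * f l)) _ nd0).
rewrite E1 E2 E3 -sumrB; apply: eq_bigr => d _; rewrite -sumrB.
by apply: eq_bigr => e _; ring.
Qed.

End MoebiusFactor.

(** * Modulus and partial summation *)

Section Modulus.
Variable R : realType.
Local Notation cmod := (@ComplexField.Normc.normc R).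
Local Notation "x %:C" := (real_complex R x).
Implicit Types (z w : R[i]) (x : R).

Lemma cmodD z w : cmod (z + w) <= cmod z + cmod w.
Proof. exact: le_normcD. Qed.

Lemma cmodN z : cmod (- z) = cmod z.
Proof. exact: normcN. Qed.

Lemma cmodB z w : cmod (z - w) <= cmod z + cmod w.
Proof. by rewrite -[cmod w]cmodN cmodD. Qed.

Lemma cmodM z w : cmod (z * w) = cmod z * cmod w.
Proof. exact: ComplexField.Normc.normcM. Qed.

Lemma cmod0 : cmod 0 = 0. Proof. exact: ComplexField.Normc.normc0. Qed.

Lemma cmod1 : cmod 1 = 1. Proof. exact: ComplexField.Normc.normc1. Qed.

Lemma cmod_ge0 z : 0 <= cmod z.
Proof. by case: z => a b; rewrite /= sqrtr_ge0. Qed.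

Lemma cmodR x : cmod x%:C = `|x|.
Proof. by rewrite /= expr0n addr0 sqrtr_sqr. Qed.

Lemma ger0_cmodR x : 0 <= x -> cmod x%:C = x.
Proof. by move=> x0; rewrite cmodR ger0_norm. Qed.

Lemma ler_cmod_sum (I : Type) (r : seq I) (P : pred I) (F : I -> R[i]) :
  cmod (\sum_(i <- r | P i) F i) <= \sum_(i <- r | P i) cmod (F i).
Proof.
elim/big_rec2: _ => [|i a z _ IH]; first by rewrite cmod0.
by apply: le_trans (cmodD _ _) _; rewrite lerD2l.
Qed.

Lemma abs_Re_le_cmod z : `|complex.Re z| <= cmod z.
Proof.
case: z => a b /=; rewrite -sqrtr_sqr ler_wsqrtr // lerDl.
exact: sqr_ge0.
Qed.

Lemma Re_le_cmod z : complex.Re z <= cmod z.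
Proof. exact: le_trans (ler_norm _) (abs_Re_le_cmod z). Qed.

Lemma Re_sum (I : Type) (r : seq I) (P : pred I) (F : I -> R[i]) :
  complex.Re (\sum_(i <- r | P i) F i) = \sum_(i <- r | P i) complex.Re (F i).
Proof. by apply: (big_morph (@complex.Re R)) => // -[a b] [c d]. Qed.

Lemma Re_realM x z : complex.Re (x%:C * z) = x * complex.Re z.
Proof. by case: z => a b /=; rewrite mul0r subr0. Qed.

(** Abel's inequality: partial summation rewrites the sum through the partial sums of [a], with
    nonnegative weights [b i - b i.+1] and a final [b n], of total [b m]. *)
Lemma abel_summation (a : nat -> R[i]) (b : nat -> R) (K : R) m n : (m <= n)%N ->
  (forall k, (m <= k <= n)%N -> cmod (\sum_(m <= i < k) a i) <= K) ->
  (forall i, (m <= i)%N -> 0 <= b i.+1 <= b i) ->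
  cmod (\sum_(m <= i < n) (b i)%:C * a i) <= K * b m.
Proof.
move=> mn aK bP.
have b0 i : (m <= i)%N -> 0 <= b i by move=> /bP/andP[/le_trans]; exact.
have K0 : 0 <= K.
  by have := aK m; rewrite leqnn mn big_geq // cmod0; apply.
pose A k := \sum_(m <= i < k) a i.
have main d : (m + d <= n)%N ->
    cmod (\sum_(m <= i < (m + d)%N) (b i)%:C * a i - (b (m + d)%N)%:C * A (m + d)%N)
      <= K * (b m - b (m + d)%N).
  elim: d => [|d IH] dn.
    by rewrite /A addn0 !big_geq // mulr0 subr0 cmod0 subrr mulr0.
  have md : (m <= m + d)%N by rewrite leq_addr.
  have /andP[_ bd] := bP _ md.
  have -> : K * (b m - b (m + d.+1)%N) =
      K * (b m - b (m + d)%N) + (b (m + d)%N - b (m + d).+1) * K.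
    by rewrite addnS; ring.
  rewrite addnS big_nat_recr //=.
  have -> : \sum_(m <= i < (m + d)%N) (b i)%:C * a i + (b (m + d)%N)%:C * a (m + d)%N
      - (b (m + d).+1)%:C * A (m + d).+1 =
    (\sum_(m <= i < (m + d)%N) (b i)%:C * a i - (b (m + d)%N)%:C * A (m + d)%N)
    + (b (m + d)%N - b (m + d).+1)%:C * A (m + d).+1.
    by rewrite /A big_nat_recr //= rmorphB /=; ring.
  apply: le_trans (cmodD _ _) (lerD _ _).
    by apply: IH; lia.
  rewrite cmodM ger0_cmodR ?subr_ge0 // ler_wpM2l ?subr_ge0 //.
  by apply: aK; rewrite -addnS leq_addr.
have := main (n - m)%N; rewrite subnKC // => /(_ (leqnn _)) H.
rewrite -[X in cmod X](subrK ((b n)%:C * A n)).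
apply: le_trans (cmodD _ _) _.
have -> : K * b m = K * (b m - b n) + b n * K by ring.
apply: lerD H _; rewrite cmodM ger0_cmodR ?b0 // ler_wpM2l ?b0 //.
by apply: aK; rewrite mn leqnn.
Qed.

Lemma abel_summationR (a b : nat -> R) (K : R) m n : (m <= n)%N ->
  (forall k, (m <= k <= n)%N -> `|\sum_(m <= i < k) a i| <= K) ->
  (forall i, (m <= i)%N -> 0 <= b i.+1 <= b i) ->
  `|\sum_(m <= i < n) b i * a i| <= K * b m.
Proof.
move=> mn aK bP.
rewrite -cmodR rmorph_sum; under eq_bigr do rewrite rmorphM.
by apply: abel_summation => // k /aK; rewrite -rmorph_sum cmodR.
Qed.

End Modulus.

(** * Theorems of Chebyshev and Mertens *)

Section Mertens.
Variable R : realType.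
Local Notation Lambda := (@vonMangoldt R).
Local Notation lnn n := (ln (n%:R : R)).
Implicit Types (d m n p q N : nat) (x : R).

Lemma ln_le_subr1 x : 0 < x -> ln x <= x - 1.
Proof.
move=> x0; have := @le_ln1Dx R (x - 1); rewrite [1 + _]addrC subrK; apply.
by lra.
Qed.

Lemma subr1_inv_le_ln x : 0 < x -> 1 - x^-1 <= ln x.
Proof.
move=> x0; have := @ln_le_subr1 x^-1; rewrite invr_gt0 => /(_ x0).
by rewrite lnV ?posrE // => H; rewrite -lerN2 opprB.
Qed.

Lemma ln_nat_ge0 n : 0 <= lnn n.
Proof. by case: n => [|n]; [rewrite ln0 | apply: ln_ge0; rewrite ler1n]. Qed.

Lemma ln_nat_gt0 n : (1 < n)%N -> 0 < lnn n.
Proof. by move=> n1; rewrite ln_gt0 // ltr1n. Qed.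

Lemma ler_ln_nat m n : (0 < m)%N -> (m <= n)%N -> lnn m <= lnn n.
Proof.
by move=> m0 mn; rewrite ler_ln ?posrE ?ltr0n ?ler_nat // (leq_trans m0).
Qed.

Lemma ltr_ln_nat m n : (0 < m)%N -> (m < n)%N -> lnn m < lnn n.
Proof.
by move=> m0 mn; rewrite ltr_ln ?posrE ?ltr0n ?ltr_nat // (leq_trans m0 (ltnW mn)).
Qed.

Lemma ln_nat_le n : lnn n <= n%:R.
Proof.
case: n => [|n]; first by rewrite ln0.
have := @ln_le_subr1 n.+1%:R; rewrite ltr0n => /(_ isT) /le_trans; apply.
by rewrite lerBlDr lerDl.
Qed.

Lemma ln_succ_le n : (0 < n)%N -> lnn n.+1 - lnn n <= n%:R^-1.
Proof.
move=> n0; rewrite -ln_div ?posrE ?ltr0n //.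
apply: le_trans (ln_le_subr1 _) _; first by rewrite divr_gt0 ?ltr0n.
by rewrite -natr1 mulrDl divff ?pnatr_eq0 -?lt0n // mul1r addrAC subrr add0r.
Qed.

Lemma ln_succ_ge n : (0 < n)%N -> n.+1%:R^-1 <= lnn n.+1 - lnn n.
Proof.
move=> n0; rewrite -ln_div ?posrE ?ltr0n //.
apply: le_trans (subr1_inv_le_ln _); last by rewrite divr_gt0 ?ltr0n.
rewrite invf_div -[X in X - _](@divff _ (n.+1%:R)) ?pnatr_eq0 // -mulrBl.
by rewrite -natrB // subSnn mul1r.
Qed.

(** Rounding down a quotient that is at least [1] at most halves it, and [ln 2 <= 1]. *)
Lemma ln_divn_ge m n : (0 < n <= m)%N -> lnn m - lnn n - 1 <= lnn (m %/ n).
Proof.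
move=> /andP[n0 nm]; have q0 : (0 < m %/ n)%N by rewrite divn_gt0.
have m0 := leq_trans n0 nm.
have l2 : ln 2 <= 1 :> R by have := @ln_le_subr1 2; lra.
have mq : (m <= m %/ n * 2 * n)%N.
  by have := divn_eq m n; have := ltn_pmod m n0; nia.
have := ler_ln_nat m0 mq; rewrite !natrM !lnM ?posrE ?mulr_gt0 ?ltr0n //.
by move: l2; lra.
Qed.

Lemma ln_divn_le m n : (0 < n <= m)%N -> lnn (m %/ n) <= lnn m - lnn n.
Proof.
move=> /andP[n0 nm]; have q0 : (0 < m %/ n)%N by rewrite divn_gt0.
have m0 := leq_trans n0 nm.
rewrite lerBrDr -lnM ?posrE ?ltr0n // -natrM ler_ln_nat ?muln_gt0 ?q0 //.
exact: leq_trunc_div.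
Qed.

Lemma harmonic_le N : \sum_(1 <= n < N.+1) (n%:R^-1 : R) <= lnn N + 1.
Proof.
elim: N => [|[|N] IH]; first by rewrite big_geq // ln0 // add0r.
  by rewrite big_nat1 ln1 invr1 add0r.
rewrite big_nat_recr //=; have := @ln_succ_ge N.+1 isT.
by move: IH; move: (N.+2%:R^-1) (\sum_(_ <= _ < _) _) => a b; lra.
Qed.

Lemma harmonic_ge N : lnn N.+1 <= \sum_(1 <= n < N.+1) (n%:R^-1 : R).
Proof.
elim: N => [|N IH]; first by rewrite big_geq // ln1.
rewrite big_nat_recr //=; have := @ln_succ_le N.+1 isT.
by move: IH; move: (N.+1%:R^-1) (\sum_(_ <= _ < _) _) => a b; lra.
Qed.

(** This is [ln = 1 * Lambda] summed up to [N]. The estimates on primes come from comparing it with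
    elementary bounds for [ln N!]. *)
Lemma ln_fact_vonMangoldt N :
  \sum_(1 <= d < N.+1) Lambda d * (N %/ d)%:R = lnn N`!.
Proof.
have := @sum_divisors_exchange _ (fun d _ => Lambda d) N.
under [X in _ = X]eq_bigr do rewrite big_const_nat subn1 iter_addr addr0 /= -mulr_natr.
move=> <-; elim: N => [|N IH]; first by rewrite big_geq // fact0 ln1.
rewrite big_nat_recr //= IH ln_sum_vonMangoldt // factS natrM lnM ?posrE ?ltr0n ?fact_gt0 //.
by rewrite addrC.
Qed.

Lemma ln_fact_le N : lnn N`! <= N%:R * lnn N.
Proof.
case: N => [|N]; first by rewrite fact0 ln1 mul0r.
rewrite mulr_natl -lnXn ?ltr0n // -natrX ler_ln_nat ?fact_gt0 //.
suff H k : (k <= N.+1)%N -> (k`! <= N.+1 ^ k)%N by exact: H.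
elim: k => // k IH kN; rewrite factS expnS leq_mul // IH //.
exact: ltnW.
Qed.

Lemma ln_fact_ge N : N%:R * lnn N - N%:R <= lnn N`!.
Proof.
elim: N => [|[|N] IH]; first by rewrite mul0r subr0 fact0 ln1.
  by rewrite (_ : 1`! = 1)%N // ln1 mulr0 add0r oppr_le0.
rewrite factS natrM lnM ?posrE ?ltr0n ?fact_gt0 //.
apply: le_trans (lerD (lexx _) IH).
have := @ln_succ_le N.+1 isT.
rewrite -(ler_pM2l (ltr0Sn R N)) divff ?pnatr_eq0 //.
move: (lnn N.+2) (lnn N.+1) => a b; rewrite -(natr1 N.+1).
by move: (N.+1%:R) => c; lra.
Qed.

(** Induction by halving. The numbers [N %/ d - 2 * (h %/ d)] are nonnegative, and at least [1] for
    [h < d <= N], so the sum over [h < d <= N] is at most [ln N! - 2 ln h!]. Up to a factor [h + 1],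
    needed when [N] is odd, this is the logarithm of a binomial coefficient, which is at most [2^N].
    The bound closes as [4h + 2N <= 4N]. *)
Lemma chebyshev_psi_le N : \sum_(1 <= d < N.+1) Lambda d <= 4 * N%:R.
Proof.
elim/ltn_ind: N => N IH; case: (posnP N) => [->|N0].
  by rewrite big_geq // mulr0.
set h := (N %/ 2)%N; have hN : (h < N)%N by rewrite ltn_Pdiv.
have h2 : (h * 2 <= N)%N by exact: leq_trunc_div.
have N2 : (N <= (h * 2).+1)%N.
  by rewrite {1}(divn_eq N 2) -/h; have := ltn_pmod N (isT : 0 < 2)%N; lia.
have key : \sum_(h.+1 <= d < N.+1) Lambda d <= lnn N`! - 2 * lnn h`!.
  have -> : 2 * lnn h`! = \sum_(1 <= d < N.+1) Lambda d * (2 * (h %/ d))%:R.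
    rewrite -ln_fact_vonMangoldt mulr_sumr [RHS](@big_cat_nat _ _ _ h.+1) //=; last by lia.
    rewrite [X in _ = _ + X]big_nat_cond [X in _ = _ + X]big1 ?addr0.
      by apply: eq_bigr => d _; rewrite natrM mulrCA.
    by move=> d /andP[/andP[hd _] _]; rewrite divn_small // muln0 mulr0.
  rewrite -ln_fact_vonMangoldt -sumrB.
  rewrite [X in _ <= X](@big_cat_nat _ _ _ h.+1) //=; last by lia.
  rewrite -[X in X <= _]add0r; apply: lerD.
    rewrite big_nat_cond; apply: sumr_ge0 => d /andP[/andP[d0 _] _].
    rewrite -mulrBr mulr_ge0 ?vonMangoldt_ge0 // subr_ge0 ler_nat.
    rewrite leq_divRL //; apply: leq_trans h2.
    by have := leq_trunc_div h d; nia.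
  apply: ler_sum_nat => d /andP[hd dN].
  rewrite (divn_small hd) muln0 mulr0 subr0 ler_peMr ?vonMangoldt_ge0 //.
  by rewrite ler1n divn_gt0 //; lia.
have up : lnn N`! - 2 * lnn h`! <= 2 * N%:R.
  have hNN : (h <= N)%N by exact: ltnW.
  have bin_le : ('C(N, h) <= 2 ^ N)%N.
    have := expnDn 1 1 N; rewrite (_ : (1 + 1)%N = 2%N) // => ->.
    under eq_bigr do rewrite !exp1n !muln1.
    by rewrite (bigD1 (Ordinal (ltnW hN : (h < N.+1)%N))) //= leq_addr.
  have f2 : ((N - h)`! <= (h.+1) * h`!)%N.
    have : (N - h = h \/ N - h = h.+1)%N by lia.
    by case=> ->; rewrite ?factS // leq_pmull.
  have : (N`! <= 2 ^ N * (h`! * (h.+1 * h`!)))%N.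
    by rewrite -(bin_fact hNN) leq_mul // leq_mul.
  move=> /ler_ln_nat - /(_ (fact_gt0 _)).
  rewrite !natrM natrX !lnM ?posrE ?mulr_gt0 ?exprn_gt0 ?ltr0n ?fact_gt0 //.
  rewrite lnXn // -mulr_natl.
  have l2 : ln 2 <= 1 :> R by have := @ln_le_subr1 2; lra.
  have lh : lnn h.+1 <= N%:R.
    by apply: le_trans (ln_nat_le _) _; rewrite ler_nat.
  have : N%:R * ln 2 <= N%:R :> R by rewrite ler_piMr.
  by move: lh; lra.
rewrite (@big_cat_nat _ _ _ h.+1) //=; last by lia.
have := IH h hN; have : h%:R * 2 <= N%:R :> R by rewrite -natrM ler_nat.
by move: key up; lra.
Qed.

(** After multiplication by [N], replacing [N/d] by [N %/ d + 1] costs a Chebyshev sum, hence at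
    most [4N]. *)
Lemma mertens_vonMangoldt_le N : (0 < N)%N ->
  \sum_(1 <= d < N.+1) Lambda d / d%:R <= lnn N + 4.
Proof.
move=> N0; have N0' : 0 < N%:R :> R by rewrite ltr0n.
rewrite -(ler_pM2l N0') mulrDr.
apply: le_trans (lerD (ln_fact_le N) (lexx _)).
rewrite [N%:R * 4]mulrC; apply: le_trans (lerD (lexx _) (chebyshev_psi_le N)).
rewrite -ln_fact_vonMangoldt -big_split mulr_sumr /=; apply: ler_sum_nat => d /andP[d0 dN].
rewrite mulrCA -[X in _ + X]mulr1 -mulrDr ler_wpM2l ?vonMangoldt_ge0 //.
rewrite natr1 ler_pdivrMr ?ltr0n // -natrM ler_nat.
by have := divn_eq N d; have := ltn_pmod N d0; nia.
Qed.

Lemma mertens_vonMangoldt_ge N : (0 < N)%N ->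
  lnn N - 1 <= \sum_(1 <= d < N.+1) Lambda d / d%:R.
Proof.
move=> N0; have N0' : 0 < N%:R :> R by rewrite ltr0n.
rewrite -(ler_pM2l N0') mulrBr mulr1.
apply: le_trans (ln_fact_ge N) _.
rewrite -ln_fact_vonMangoldt mulr_sumr /=; apply: ler_sum_nat => d /andP[d0 dN].
rewrite mulrCA ler_wpM2l ?vonMangoldt_ge0 //.
by rewrite ler_pdivlMr ?ltr0n // -natrM ler_nat leq_trunc_div.
Qed.

Lemma prime_dvdn_fact p N : prime p -> (p %| N`!)%N -> (p <= N)%N.
Proof.
move=> pp; elim: N => [|N IH]; first by rewrite fact0 Euclid_dvd1.
by rewrite factS Euclid_dvdM // => /orP[/dvdn_leq -> //|/IH /leqW].
Qed.

Lemma sum_ln_div_consecutive N :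
  \sum_(1 <= n < N.+1) lnn n.+1 / (n%:R * n.+1%:R) <= 2 :> R.
Proof.
(* A telescoping majorant: [u n - u n.+1] dominates the [n]-th term because
   [n (ln (n+1) - ln n) <= 1], and [u 1 = 2] is the bound. *)
pose u n : R := (lnn n + 2) / n%:R.
suff H : \sum_(1 <= n < N.+1) lnn n.+1 / (n%:R * n.+1%:R) <= 2 - u N.+1.
  apply: le_trans H _; rewrite lerBlDr lerDl /u divr_ge0 // addr_ge0 //.
  exact: ln_nat_ge0.
elim: N => [|N IH]; first by rewrite big_geq // /u ln1 add0r divr1 subrr.
rewrite big_nat_recr //=.
suff : lnn N.+2 / (N.+1%:R * N.+2%:R) <= u N.+1 - u N.+2.
  by move: IH; move: (_ / _) (\sum_(_ <= _ < _) _) (u N.+1) (u N.+2) => a b c d; lra.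
have n0 : 0 < N.+1%:R :> R by rewrite ltr0n.
have n1 : N.+2%:R = N.+1%:R + 1 :> R by rewrite natr1.
have n2 : 0 < N.+2%:R :> R by rewrite ltr0n.
have -> : u N.+1 - u N.+2 =
    (lnn N.+1 + 2 - N.+1%:R * (lnn N.+2 - lnn N.+1)) / (N.+1%:R * N.+2%:R).
  rewrite /u; move: n1 n2 => -> n2; field.
  by rewrite !gt_eqF.
rewrite ler_pM2r ?invr_gt0 ?mulr_gt0 //.
have := @ln_succ_le N.+1 isT => D.
have : N.+1%:R * (lnn N.+2 - lnn N.+1) <= 1.
  by move: D; move: (_ - _) => a D; rewrite mulrC -ler_pdivlMr // mul1r.
have : N.+1%:R^-1 <= 1 :> R by rewrite invf_le1 // ler1n.
by move: D; move: (N.+1%:R^-1) (N.+1%:R * _) => a b; lra.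
Qed.

Lemma sum_inv_powers_le (x : R) v : 1 < x ->
  \sum_(2 <= j < v.+1) (x ^+ j)^-1 <= (x * (x - 1))^-1.
Proof.
move=> x1; have x0 : 0 < x by lra.
have xx : 0 < x - 1 by lra.
case: v => [|v]; first by rewrite big_geq // invr_ge0 mulr_ge0 // ltW.
suff H : \sum_(2 <= j < v.+2) (x ^+ j)^-1 <= (x * (x - 1))^-1 - (x ^+ v.+1 * (x - 1))^-1.
  by apply: le_trans H _; rewrite lerBlDr lerDl invr_ge0 mulr_ge0 ?exprn_ge0 // ltW.
elim: v => [|v IH]; first by rewrite big_geq // expr1 subrr.
rewrite big_nat_recr //=; apply: le_trans (lerD IH (lexx _)) _.
have xv : x ^+ v.+1 != 0 by rewrite expf_neq0 // gt_eqF.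
rewrite [X in X <= _](_ : _ = (x * (x - 1))^-1 - (x ^+ v.+2 * (x - 1))^-1) //.
rewrite [x ^+ v.+2]exprS; move: (x ^+ v.+1) xv => w w0; field.
by rewrite w0 !gt_eqF.
Qed.

Lemma sum_vonMangoldt_nonprime_le N :
  \sum_(1 <= d < N.+1 | ~~ prime d) Lambda d / d%:R <= 2.
Proof.
pose F d : R := (~~ prime d)%:R / d%:R.
have F0 d : 0 <= F d by rewrite divr_ge0.
have N0 := fact_gt0 N.
have -> : \sum_(1 <= d < N.+1 | ~~ prime d) Lambda d / d%:R =
    \sum_(1 <= d < N.+1) Lambda d * F d.
  rewrite big_mkcond; apply: eq_bigr => d _; rewrite /F.
  by case: (prime d) => //=; rewrite ?mul0r ?mulr0 ?mul1r.
(* Every [d <= N] divides [N!]; enlarging the range to all divisors of [N!] allows grouping by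
   primes, and each prime then gives a geometric series. *)
apply: (@le_trans _ _ (\sum_(d <- divisors N`!) Lambda d * F d)).
  rewrite (perm_big [seq d <- divisors N`! | (0 < d <= N)%N]); last first.
    apply: uniq_perm; rewrite ?filter_uniq ?iota_uniq ?divisors_uniq // => d.
    rewrite mem_index_iota mem_filter -dvdn_divisors // ltnS.
    by case: (boolP (0 < d <= N)%N) => //= /dvdn_fact ->.
  rewrite big_filter big_mkcond; apply: ler_sum => d _.
  by case: ifP => // _; rewrite mulr_ge0 ?vonMangoldt_ge0.
rewrite sum_divisors_vonMangoldt //.
apply: (@le_trans _ _ (\sum_(p <- primes N`!) lnn p / (p.-1%:R * p%:R))).
  rewrite big_seq [X in _ <= X]big_seq; apply: ler_sum => p.
  rewrite mem_primes => /and3P[pp _ pN].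
  have p1 := prime_gt1 pp.
  have v0 : (0 < logn p N`!)%N by rewrite logn_gt0 mem_primes pp N0.
  rewrite big_ltn ?ltnS // -mulr_sumr /F expn1 pp /= !mul0r mulr0 add0r.
  rewrite ler_wpM2l ?ln_nat_ge0 //.
  have := @sum_inv_powers_le p%:R (logn p N`!); rewrite ltr1n => /(_ p1).
  rewrite -subn1 natrB ?prime_gt0 // [(_ - 1) * _]mulrC; apply: le_trans.
  apply: ler_sum => j _; rewrite natrX ler_pdivrMr ?exprn_gt0 ?ltr0n ?prime_gt0 //.
  by rewrite mulVf ?expf_neq0 ?pnatr_eq0 -?lt0n ?prime_gt0 // lern1 leq_b1.
apply: le_trans (sum_ln_div_consecutive N).
rewrite (perm_big [seq p <- index_iota 2 N.+2 | p \in primes N`!]); last first.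
  apply: uniq_perm; rewrite ?filter_uniq ?iota_uniq ?primes_uniq // => p.
  rewrite mem_filter mem_index_iota; case: (boolP (p \in _)) => //=.
  rewrite mem_primes => /and3P[pp _ /(prime_dvdn_fact pp) pN].
  by rewrite prime_gt1 // ltnS leqW.
rewrite big_filter big_mkcond /= big_add1 /=; apply: ler_sum => n _.
by case: ifP => // _; rewrite divr_ge0 ?mulr_ge0 ?ln_nat_ge0.
Qed.

Definition prime_weight n : R := if prime n then lnn n / n%:R else 0.

Lemma prime_weight_ge0 n : 0 <= prime_weight n.
Proof. by rewrite /prime_weight; case: ifP => // _; rewrite divr_ge0 ?ln_nat_ge0. Qed.

Lemma prime_weight_le1 n : prime_weight n <= 1.
Proof.
rewrite /prime_weight; case: ifP => // /prime_gt0 n0.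
by rewrite ler_pdivrMr ?ltr0n // mul1r ln_nat_le.
Qed.

Lemma mertens_prime N : (0 < N)%N ->
  `|\sum_(1 <= n < N.+1) prime_weight n - lnn N| <= 4.
Proof.
move=> N0; have := mertens_vonMangoldt_le N0; have := mertens_vonMangoldt_ge N0.
have := sum_vonMangoldt_nonprime_le N.
have : 0 <= \sum_(1 <= d < N.+1 | ~~ prime d) Lambda d / d%:R.
  by apply: sumr_ge0 => d _; rewrite divr_ge0 ?vonMangoldt_ge0.
have -> : \sum_(1 <= d < N.+1) Lambda d / d%:R =
    \sum_(1 <= n < N.+1) prime_weight n +
    \sum_(1 <= d < N.+1 | ~~ prime d) Lambda d / d%:R.
  rewrite (bigID prime) /=; congr (_ + _); rewrite big_mkcond.
  apply: eq_bigr => d _; rewrite /prime_weight.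
  by case: ifP => // /vonMangoldt_prime ->.
by rewrite ler_norml; lra.
Qed.

End Mertens.

(** * Selection of primes *)

Section PrimeSums.
Variable R : realType.
Local Notation lnn n := (ln (n%:R : R)).
Local Notation pw := (@prime_weight R).
Implicit Types (m n q y X z N : nat).

Definition prime_inv n : R := if prime n then n%:R^-1 else 0.

Lemma prime_inv_ge0 n : 0 <= prime_inv n.
Proof. by rewrite /prime_inv; case: ifP. Qed.

Lemma prime_weightE n : pw n = prime_inv n * lnn n.
Proof.
by rewrite /prime_weight /prime_inv; case: ifP => _; rewrite ?mul0r // mulrC.
Qed.

Lemma prime_invE n : (1 < n)%N -> prime_inv n = (lnn n)^-1 * pw n.
Proof.
move=> n1; rewrite prime_weightE mulrCA mulVf ?mulr1 //.
by rewrite gt_eqF // ln_nat_gt0.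
Qed.

Lemma inv_ln_nat_noninc i : (1 < i)%N -> 0 <= (lnn i.+1)^-1 <= (lnn i)^-1.
Proof.
move=> i1; rewrite invr_ge0 ln_nat_ge0 /= lef_pV2 ?posrE ?ln_nat_gt0 //.
- by rewrite ler_ln_nat // ltnW.
- exact: ltnW.
Qed.

Lemma sum_nat_subr (V : zmodType) (F : nat -> V) m n : (m <= n)%N ->
  \sum_(m.+1 <= i < n.+1) F i =
  \sum_(1 <= i < n.+1) F i - \sum_(1 <= i < m.+1) F i.
Proof.
move=> mn; rewrite [X in _ = X - _](@big_cat_nat _ _ _ m.+1) //=.
by rewrite addrAC subrr add0r.
Qed.

Lemma sum_ln_diff m n : (0 < m <= n)%N ->
  \sum_(m.+1 <= i < n.+1) (lnn i - lnn i.-1) = lnn n - lnn m.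
Proof.
move=> /andP[m0 mn]; rewrite big_add1 /=.
by rewrite (telescope_sumr (fun i => lnn i)).
Qed.

Lemma mertens_prime_interval m n : (0 < m <= n)%N ->
  `|\sum_(m.+1 <= i < n.+1) pw i - (lnn n - lnn m)| <= 8.
Proof.
move=> /andP[m0 mn]; rewrite sum_nat_subr //.
have := mertens_prime R m0; have := mertens_prime R (leq_trans m0 mn).
by rewrite !ler_norml; lra.
Qed.

(** Partial summation from the first theorem. With [D n = ln n - ln (n-1)], the partial sums of
    [pw - D] are bounded by [8], which costs [8 / ln y] against the weight [1 / ln n]. The remaining
    sum of [D n / ln n] is a Riemann sum for the increment of [ln ln]; its error telescopes, since
    [D n <= 1], to at most [1 / ln y]. *)
Lemma mertens_second y X : (1 < y <= X)%N ->
  `|\sum_(y.+1 <= n < X.+1) prime_inv n - (ln (lnn X) - ln (lnn y))| <= 9 / lnn y.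
Proof.
move=> /andP[y1 yX]; have y0 : (0 < y)%N by exact: ltnW.
have ly := @ln_nat_gt0 R _ y1.
pose b n := (lnn n)^-1; pose D n := lnn n - lnn n.-1.
have H1 : `|\sum_(y.+1 <= n < X.+1) b n * (pw n - D n)| <= 8 * b y.+1.
  apply: abel_summationR => //.
  - move=> [//|k] /andP[yk kX].
    by rewrite sumrB sum_ln_diff ?y0 // mertens_prime_interval // y0.
  - by move=> i yi; apply: inv_ln_nat_noninc; rewrite (leq_trans y1) // ltnW.
have b1 : b y.+1 <= b y by have /andP[] := inv_ln_nat_noninc y1.
have H2 : 0 <= (ln (lnn X) - ln (lnn y)) - \sum_(y.+1 <= n < X.+1) b n * D n <= b y - b X.
  rewrite -(subnKC yX); elim: (X - y)%N => [|d IH].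
    by rewrite addn0 big_geq // !subrr lexx.
  have yd : (y < (y + d).+1)%N by rewrite ltnS leq_addr.
  rewrite addnS big_nat_recr //=.
  have n1 : (1 < y + d)%N by rewrite (leq_trans y1) ?leq_addr.
  have l0 := @ln_nat_gt0 R _ n1; have l1 := @ln_nat_gt0 R _ (leqW n1).
  have llp : ln (lnn (y + d).+1) - ln (lnn (y + d)) = ln (lnn (y + d).+1 / lnn (y + d)).
    by rewrite ln_div ?posrE.
  have D1 : D (y + d).+1 <= 1.
    rewrite /D /=; apply: le_trans (ln_succ_le R (ltnW n1)) _.
    by rewrite invf_le1 ?ltr0n ?ler1n ltnW.
  have D0 : 0 <= D (y + d).+1 by rewrite subr_ge0 ler_ln_nat // ltnW.
  have up : ln (lnn (y + d).+1 / lnn (y + d)) <= b (y + d)%N * D (y + d).+1.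
    apply: le_trans (ln_le_subr1 _) _; first by rewrite divr_gt0.
    by rewrite /b /D /= [X in _ <= X]mulrC mulrBl divff ?gt_eqF.
  have lo : b (y + d).+1 * D (y + d).+1 <= ln (lnn (y + d).+1 / lnn (y + d)).
    apply: le_trans (subr1_inv_le_ln _); last by rewrite divr_gt0.
    by rewrite /b /D invf_div /= [X in X <= _]mulrC mulrBl divff ?gt_eqF.
  have bb : b (y + d).+1 <= b (y + d)%N by have /andP[] := inv_ln_nat_noninc n1.
  have : (b (y + d)%N - b (y + d).+1) * D (y + d).+1 <= b (y + d)%N - b (y + d).+1.
    by rewrite ler_piMr // subr_ge0.
  move: IH up lo; rewrite -llp.
  move: (b (y + d)%N) (b (y + d).+1) (D (y + d).+1) => b1' b2 D'.
  move: (\sum_(_ <= _ < _) _) (ln _) (ln _) (ln _) (b y) => s l2 l3 l4 b3.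
  move=> IH up lo; rewrite mulrBl; move: IH; move: (b1' * D') (b2 * D') up lo => x1 x2; lra.
have bX : 0 <= b X by rewrite invr_ge0 ln_nat_ge0.
have -> : \sum_(y.+1 <= n < X.+1) prime_inv n =
    \sum_(y.+1 <= n < X.+1) b n * (pw n - D n) + \sum_(y.+1 <= n < X.+1) b n * D n.
  rewrite -big_split; apply: eq_big_nat => n /andP[yn _] /=.
  by rewrite -mulrDr subrK prime_invE // (leq_trans y1) // ltnW.
rewrite -/(b y); move: H1 H2 b1 bX; move: (b y) (b y.+1) (b X) => b0 b1 b2.
rewrite !ler_norml.
move: (\sum_(_ <= _ < _) _) (\sum_(_ <= _ < _) _) (ln _) (ln _) => s1 s2 s3 s4.
by lra.
Qed.

(** Each sign is chosen against the current partial sum: negative exactly when that sum is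
    positive. *)
Lemma ex_balancing_signs (a : nat -> R) : (forall n, 0 <= a n <= 1) ->
  exists s : nat -> bool,
    forall N, `|\sum_(1 <= n < N.+1) (-1) ^+ s n * a n| <= 1.
Proof.
move=> a01.
have [s sE] := course_of_values false
  (fun (s : nat -> bool) n => 0 < \sum_(1 <= m < n) (-1) ^+ s m * a m).
exists s; elim=> [|N IH]; first by rewrite big_geq // normr0.
rewrite big_nat_recr //= sE.
rewrite (_ : \sum_(1 <= m < N.+1) (-1) ^+ (if (m < N.+1)%N then s m else false) * a m
    = \sum_(1 <= n < N.+1) (-1) ^+ s n * a n); last first.
  by apply: eq_big_nat => m /andP[_ ->].
have := a01 N.+1; move: IH; rewrite !ler_norml.
by case: ltP => h; rewrite ?expr1 ?expr0; lra.
Qed.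

(* Beyond [X], a prime is selected exactly when the running weight [t] does not
   exceed its target [u]; Mertens' theorem lets [t] catch up with [u], which by
   averaging grows no faster than the weight of all primes. *)
Lemma ex_greedy_selection y X : (1 < y)%N -> (y < X < y * y)%N ->
  let W := \sum_(y.+1 <= q < X.+1) prime_inv q in 0 < W ->
  exists e : nat -> bool,
  let t z := \sum_(1 <= n < z.+1) (e n)%:R * pw n in
  [/\ forall n, (n <= y)%N -> e n = false,
      forall n, (y < n <= X)%N -> e n = true &
      forall z, (X <= z)%N ->
        `|t z - (t X + \sum_(y.+1 <= q < X.+1) prime_inv q / W * t (z %/ q)%N)| <= 17].
Proof.
move=> y1 /andP[yX Xyy] W W0.
pose T (e : nat -> bool) z := \sum_(1 <= n < z.+1) (e n)%:R * pw n.
pose U e z := T e X + \sum_(y.+1 <= q < X.+1) prime_inv q / W * T e (z %/ q)%N.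
have [e eE] := course_of_values false (fun (e : nat -> bool) n =>
  (y < n)%N && ((n <= X)%N || (T e n.-1 <= U e n))).
exists e; pose t := T e; pose u := U e.
have ey n : (n <= y)%N -> e n = false by rewrite eE leqNgt => /negPf ->.
have eX n : (y < n <= X)%N -> e n = true by rewrite eE => /andP[-> ->].
split=> //.
have Tt n z : (z < n)%N -> T (fun m => if (m < n)%N then e m else false) z = t z.
  move=> zn; apply: eq_big_nat => m /andP[_ mz].
  by rewrite (leq_trans mz zn).
have egt n : (X < n)%N -> e n = (t n.-1 <= u n).
  move=> Xn; have yn := ltn_trans yX Xn; rewrite eE yn leqNgt Xn /=.
  rewrite Tt; last by rewrite prednK // (leq_ltn_trans _ Xn).
  rewrite /U Tt //; congr (_ <= _ + _); apply: eq_big_nat => q /andP[yq qX].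
  rewrite Tt // ltn_Pdiv //; first by rewrite (leq_trans y1) // ltnW.
  exact: leq_trans Xn.
have tS z : t z.+1 = t z + (e z.+1)%:R * pw z.+1 by rewrite /t /T big_nat_recr.
have ipw z : 0 <= (e z)%:R * pw z <= pw z.
  by case: (e z); rewrite ?mul1r ?mul0r ?lexx prime_weight_ge0.
have tD a b : (a <= b)%N -> 0 <= t b - t a <= \sum_(a.+1 <= i < b.+1) pw i.
  move=> ab; rewrite /t /T -sum_nat_subr //; apply/andP; split.
    by apply: sumr_ge0 => i _; have /andP[] := ipw i.
  by apply: ler_sum => i _; have /andP[] := ipw i.
have w0 q : 0 <= prime_inv q / W by rewrite divr_ge0 ?prime_inv_ge0 // ltW.
have w1 : \sum_(y.+1 <= q < X.+1) prime_inv q / W = 1.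
  by rewrite -mulr_suml divff // gt_eqF.
have uD a b : u b - u a =
    \sum_(y.+1 <= q < X.+1) prime_inv q / W * (t (b %/ q)%N - t (a %/ q)%N).
  rewrite /u /U opprD addrACA subrr add0r -sumrB.
  by apply: eq_bigr => q _; rewrite mulrBr.
have u_mono a b : (a <= b)%N -> u a <= u b.
  move=> ab; rewrite -subr_ge0 uD; apply: sumr_ge0 => q _.
  by rewrite mulr_ge0 //; have /andP[] := tD _ _ (leq_div2r q ab).
(* As [X < y * y], all arguments [X %/ q] lie below [y], where nothing is selected. *)
have uX : u X = t X.
  rewrite /u /U big_nat_cond big1 ?addr0 // => q /andP[/andP[yq _] _].
  have Xq : (X %/ q < y)%N.
    by rewrite ltn_divLR ?(leq_trans _ yq) // (leq_trans Xyy) // leq_mul2l ltnW ?orbT.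
  rewrite /T big_nat_cond big1 ?mulr0 // => n /andP[/andP[_ nq] _].
  by rewrite ey ?mul0r // -ltnS (leq_trans nq) // ltnW.
(* A prime is selected only if [t] has not passed its target, and it adds at most [1]; the target
   itself never decreases. *)
have upper z : (X <= z)%N -> t z <= u z + 1.
  move=> /subnKC <-; elim: (z - X)%N => [|d IH].
    by rewrite addn0 uX lerDl.
  have um := u_mono _ _ (leqnSn (X + d)); have pw1 := prime_weight_le1 R (X + d).+1.
  rewrite addnS tS egt ?ltnS ?leq_addr //=; move: um pw1 IH.
  by case: (leP (t _) (u _.+1)) => h; rewrite ?mul1r ?mul0r; lra.
(* [z0] is the last place up to [z] where the target was reached; every prime after it has been
   selected. *)
have lower z : (X <= z)%N -> exists z0, [/\ (X <= z0 <= z)%N, u z0 <= t z0 &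
    t z - t z0 = \sum_(z0.+1 <= i < z.+1) pw i].
  move=> /subnKC <-; elim: (z - X)%N => [|d [z0 [Xz0 uz0 tz0]]].
    by exists X; rewrite addn0 leqnn uX subrr big_geq.
  case: (leP (u (X + d.+1)%N) (t (X + d.+1)%N)) => [ut|tu].
    by exists (X + d.+1)%N; rewrite leqnn leq_addr subrr big_geq.
  exists z0; split => //; first by case/andP: Xz0 => -> /=; rewrite addnS; exact: leqW.
  move: tu; rewrite addnS tS egt ?ltnS ?leq_addr //=.
  case: (leP (t (X + d)%N) (u (X + d).+1)) => [_ _|ut]; last first.
    by rewrite mul0r addr0 => /(lt_trans ut); rewrite ltxx.
  rewrite mul1r addrAC tz0 [RHS]big_nat_recr //=.
  by case/andP: Xz0.
move=> z Xz; change (`|t z - u z| <= 17); rewrite ler_norml.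
have := upper z Xz; have [z0 [/andP[Xz0 z0z] uz0 tz0]] := lower z Xz.
(* The increment of [u] is an average of increments of [t] between [z0 %/ q] and [z %/ q], each at
   most about [ln z - ln z0]. The [17] collects [8] from Mertens on this interval, [8] on the
   divided one and [1] for rounding the quotients. *)
suff : u z - u z0 <= \sum_(z0.+1 <= i < z.+1) pw i + 17 by move: uz0 tz0; lra.
have z00 : (0 < z0)%N by exact: leq_trans (leq_trans _ yX) Xz0.
have zz : (0 < z0 <= z)%N by rewrite z00.
have := mertens_prime_interval zz; rewrite ler_norml => /andP[M1 _].
suff : u z - u z0 <= lnn z - lnn z0 + 9 by move: M1; lra.
rewrite uD; have -> : lnn z - lnn z0 + 9 =
    \sum_(y.+1 <= q < X.+1) prime_inv q / W * (lnn z - lnn z0 + 9).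
  by rewrite -mulr_suml w1 mul1r.
apply: ler_sum_nat => q /andP[yq qX].
apply: ler_wpM2l => //.
have q0 : (0 < q)%N by exact: leq_trans yq.
have qz0 : (q <= z0)%N by exact: leq_trans Xz0.
have qz : (q <= z)%N by exact: leq_trans z0z.
have /andP[_ /le_trans] := tD _ _ (leq_div2r q z0z); apply.
have qq : (0 < z0 %/ q <= z %/ q)%N by rewrite divn_gt0 // qz0 leq_div2r.
have := mertens_prime_interval qq; rewrite ler_norml => /andP[_].
have q0z : (0 < q <= z)%N by rewrite q0.
have q0z0 : (0 < q <= z0)%N by rewrite q0.
have := @ln_divn_le R _ _ q0z; have := @ln_divn_ge R _ _ q0z0.
move: (\sum_(_ <= _ < _) _) (lnn (z %/ q)) (lnn (z0 %/ q)) (lnn z) (lnn z0) (lnn q).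
by move=> a b c d f g; lra.
Qed.

End PrimeSums.

(** * Mean values through [f = 1 * g] *)

Section CompletelyMultiplicative.
Variable R : realType.
Local Notation cmod := (@ComplexField.Normc.normc R).
Implicit Types (v : nat -> R[i]) (m n p N : nat).

Definition cmul_extension v n : R[i] := \prod_(p <- primes n) v p ^+ logn p n.

(** A range of bases that does not depend on [n], so that the factors of [m], [n] and [m * n] can be
    compared one by one; the exponent vanishes off the prime divisors. *)
Lemma cmul_extensionE v n N : (0 < n <= N)%N ->
  cmul_extension v n = \prod_(1 <= p < N.+1) v p ^+ logn p n.
Proof.
move=> /andP[n0 nN]; rewrite /cmul_extension.
rewrite [RHS](bigID (fun p => p \in primes n)) /= [X in _ * X]big1 ?mulr1.
  rewrite -[RHS]big_filter; apply: perm_big; apply: uniq_perm.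
  - exact: primes_uniq.
  - by rewrite filter_uniq // iota_uniq.
  move=> p; rewrite mem_filter mem_index_iota.
  case: (boolP (p \in primes n)) => //=; rewrite mem_primes => /and3P[pp _ pn].
  by rewrite prime_gt0 // ltnS (leq_trans (dvdn_leq n0 pn)).
by move=> p; rewrite -logn_gt0 -eqn0Ngt => /eqP ->.
Qed.

Lemma cmul_extension_completely_multiplicative v :
  completely_multiplicative (cmul_extension v).
Proof.
split; first by rewrite /cmul_extension big_nil.
move=> m n m0 n0.
rewrite !(@cmul_extensionE v _ (m * n)) ?muln_gt0 ?m0 ?n0 ?leqnn ?leq_pmulr ?leq_pmull //.
by rewrite -big_split; apply: eq_bigr => p _; rewrite lognM // exprD.
Qed.

Lemma cmul_extension_prime v p : prime p -> cmul_extension v p = v p.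
Proof.
by move=> pp; rewrite /cmul_extension primes_prime // big_seq1 logn_prime // eqxx expr1.
Qed.

Lemma cmod_cmul_extension v n : (forall p, cmod (v p) = 1) -> cmod (cmul_extension v n) = 1.
Proof.
move=> v1; rewrite /cmul_extension; elim/big_rec: _ => [|p z _ IH]; first exact: cmod1.
rewrite cmodM IH mulr1; elim: (logn p n) => [|j IHj]; first by rewrite expr0 cmod1.
by rewrite exprS cmodM v1 IHj mulr1.
Qed.

Lemma cmul_extension_eq1 v n y : (forall p, (p <= y)%N -> v p = 1) ->
  (0 < n <= y)%N -> cmul_extension v n = 1.
Proof.
move=> v1 /andP[n0 ny]; rewrite /cmul_extension big1_seq // => p /andP[_].
rewrite mem_primes => /and3P[_ _ /(dvdn_leq n0) pn].
by rewrite v1 ?expr1n // (leq_trans pn).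
Qed.

End CompletelyMultiplicative.

(** * Size of the quotient [g], and propagation of small means by the renewal equation *)

Section QuotientBounds.
Variable R : realType.
Local Notation C := R[i].
Local Notation cmod := (@ComplexField.Normc.normc R).
Local Notation "x %:C" := (real_complex R x).
Local Notation Lambda := (@vonMangoldt R).
Local Notation lnn n := (ln (n%:R : R)).
Variables (f g : nat -> C) (y X : nat).
Hypothesis fM : completely_multiplicative f.
Hypothesis f_le1 : forall n, (0 < n)%N -> cmod (f n) <= 1.
Hypothesis f_small : forall n, (0 < n <= y)%N -> f n = 1.
Hypothesis gE : forall n, (0 < n)%N -> \sum_(d <- divisors n) g d = f n.
Hypothesis y2 : 1 <= lnn y.
Hypothesis yX : (y < X < y * y)%N.
Implicit Types (d m n q z N : nat).

Let y1 : (1 < y)%N.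
Proof.
rewrite ltnNge; apply/negP => y1.
have : lnn y <= 0 by apply: ln_le0; rewrite lern1.
by move: y2; lra.
Qed.

Let y_gt0 : (0 < y)%N. Proof. exact: ltnW. Qed.

Let ly0 : 0 < lnn y. Proof. exact: lt_le_trans y2. Qed.

Lemma invn_natC n : (n%:R^-1 : C) = (n%:R^-1)%:C.
Proof. by rewrite fmorphV rmorph_nat. Qed.

Lemma cmod_natV n : cmod (n%:R^-1) = n%:R^-1.
Proof. by rewrite invn_natC ger0_cmodR // invr_ge0. Qed.

Let g_ln n (n0 : (0 < n)%N) := dirichlet_quotient_ln fM gE n0.

Lemma dirichlet_quotient1 : g 1%N = 1.
Proof. by have := gE (ltn0Sn 0); rewrite big_seq1; case: fM => ->. Qed.

Lemma cmod_subr1_le2 n : (0 < n)%N -> cmod (1 - f n) <= 2.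
Proof.
move=> n0; apply: le_trans (cmodB _ _) _; rewrite cmod1 -[2]/(1 + 1).
by rewrite lerD2l f_le1.
Qed.

Lemma ln_natC_neq0 n : (1 < n)%N -> (lnn n)%:C != 0.
Proof. by move=> n1; rewrite fmorph_eq0 gt_eqF // ln_nat_gt0. Qed.

Lemma dirichlet_quotient_small n : (1 < n <= y)%N -> g n = 0.
Proof.
move=> /andP[n1 ny]; have n0 := ltnW n1.
apply/eqP; rewrite -(mulIr_eq0 _ (mulIf (ln_natC_neq0 n1))) g_ln //.
rewrite big_seq big1 // => d; rewrite -dvdn_divisors // => dn.
rewrite f_small ?subrr ?mulr0 // divn_dvd_gt0 //=.
exact: leq_trans (leq_div _ _) ny.
Qed.

(** In the logarithmic derivative only [d = 1] survives: [g d = 0] for [1 < d <= y], and [n/d < y],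
    so [f (n/d) = 1], for [d > y]. The remaining factor vanishes at proper prime powers because
    their base is below [y]. *)
Lemma dirichlet_quotient_middle n : (y < n <= X)%N ->
  g n = if prime n then f n - 1 else 0.
Proof.
move=> /andP[yn nX]; have n1 := ltn_trans y1 yn; have n0 := ltnW n1.
have nyy : (n < y * y)%N by rewrite (leq_ltn_trans nX) //; case/andP: yX.
apply: (mulIf (ln_natC_neq0 n1)); rewrite g_ln //.
have n1s : 1%N \in divisors n by rewrite -dvdn_divisors // dvd1n.
rewrite (big_rem _ n1s) /= divn1 dirichlet_quotient1 mul1r big1_seq ?addr0.
  case: ifP => [pn|npn]; first by rewrite vonMangoldt_prime // mulrC.
  rewrite mul0r /Lambda; case E: (primes n) => [|p [|? ?]]; rewrite ?rmorph0 ?mul0r //.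
  have pp : prime p.
    by have : p \in primes n; [rewrite E inE | rewrite mem_primes => /andP[]].
  have /(primes_eq1P n pp)[j j0 nE] : primes n == [:: p] by rewrite E.
  have j2 : (1 < j)%N by case: j j0 nE npn => [|[|]] // _ ->; rewrite expn1 pp.
  have py : (p < y)%N.
    rewrite ltnNge; apply/negP => yp; move: nyy; rewrite ltnNge; case/negP.
    rewrite nE -(subnKC j2) expnD -mulnn.
    by rewrite (leq_trans (leq_mul yp yp)) // leq_pmulr // expn_gt0 prime_gt0.
  have -> : f n = 1.
    rewrite nE; elim: j {j0 nE j2} => [|j IH]; first by case: fM.
    case: (fM) => _ fMM; rewrite expnS fMM ?expn_gt0 ?prime_gt0 // IH mulr1.
    by rewrite f_small // prime_gt0 // ltnW.
  by rewrite subrr mulr0.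
move=> d /andP[_]; rewrite mem_rem_uniq ?divisors_uniq // inE -dvdn_divisors //.
move=> /andP[d1 dn]; have d0 := dvdn_gt0 n0 dn.
case: (leqP d y) => dy.
  rewrite dirichlet_quotient_small ?mul0r // dy andbT.
  by case: d d1 d0 {dn dy} => [|[|]].
rewrite f_small ?subrr ?mulr0 // divn_dvd_gt0 //= ltnW //.
by rewrite ltn_divLR // (leq_trans nyy) // leq_mul2l ltnW ?orbT.
Qed.

(* [defect_sum] and [glogsum] below are the functions [T] and [G] of the introduction. *)
Definition defect q : C := (Lambda q / q%:R)%:C * (1 - f q).
Definition defect_sum z : C := \sum_(1 <= q < z.+1) defect q.

Lemma defect_small q : (q <= y)%N -> defect q = 0.
Proof.
case: q => [|q] qy; first by rewrite /defect invr0 mulr0 rmorph0 mul0r.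
by rewrite /defect f_small // subrr mulr0.
Qed.

Lemma defect_sum_small z : (z <= y)%N -> defect_sum z = 0.
Proof.
move=> zy; rewrite /defect_sum big_nat_cond big1 // => q /andP[/andP[_ qz] _].
by rewrite defect_small // (leq_trans _ zy).
Qed.

Lemma cmod_defect_le q : cmod (defect q) <= 2 * (Lambda q / q%:R).
Proof.
case: q => [|q].
  by rewrite defect_small // cmod0 mulr_ge0 // divr_ge0 ?vonMangoldt_ge0.
have L0 : 0 <= Lambda q.+1 / q.+1%:R by rewrite divr_ge0 ?vonMangoldt_ge0.
by rewrite /defect cmodM ger0_cmodR // mulrC ler_wpM2r // cmod_subr1_le2.
Qed.

Lemma sum_cmod_defect_le z : (0 < z)%N ->
  \sum_(1 <= q < z.+1) cmod (defect q) <= 2 * (lnn z + 4).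
Proof.
move=> z0; apply: le_trans (ler_sum _ (fun q _ => cmod_defect_le q)) _.
by rewrite -mulr_sumr ler_wpM2l // mertens_vonMangoldt_le.
Qed.

Lemma dirichlet_quotient_ln_div n : (0 < n)%N ->
  (lnn n)%:C * (g n / n%:R) =
  - \sum_(d <- divisors n) (g d / d%:R) * defect (n %/ d)%N.
Proof.
move=> n0; rewrite mulrCA mulrA g_ln // mulr_suml -sumrN [LHS]big_seq [RHS]big_seq.
apply: eq_bigr => d; rewrite -dvdn_divisors // => dn.
have d0 := dvdn_gt0 n0 dn.
have -> : n%:R^-1 = d%:R^-1 * (n %/ d)%:R^-1 :> C.
  by rewrite -invfM -natrM mulnC divnK.
rewrite /defect rmorphM /= -invn_natC.
by move: (d%:R^-1) ((n %/ d)%:R^-1) => a b; ring.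
Qed.

Definition glognorm x := \sum_(1 <= d < x.+1) cmod (g d) / d%:R.
(** Bounds the error made in replacing [N %/ d] by [N/d] in the mean value of [f]. *)
Definition gnorm x := \sum_(1 <= d < x.+1) cmod (g d).

Lemma glognorm_ge0 x : 0 <= glognorm x.
Proof. by apply: sumr_ge0 => d _; rewrite divr_ge0 ?cmod_ge0. Qed.

Lemma cmod_quotient_ln_le n : (0 < n)%N ->
  cmod (g n) * lnn n <=
  \sum_(d <- divisors n) cmod (g d) * (Lambda (n %/ d) * cmod (1 - f (n %/ d)%N)).
Proof.
move=> n0; rewrite -[lnn n](ger0_cmodR (ln_nat_ge0 R n)) -cmodM g_ln //.
apply: le_trans (ler_cmod_sum _ _ _) _; apply: ler_sum => d _.
rewrite !cmodM ger0_cmodR ?vonMangoldt_ge0 //.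
by rewrite -[cmod (1 - _)]cmodN opprB.
Qed.

(** Apart from [1], the support of [g] lies above [y], which provides the factor [ln y]. The defects
    also live above [y], so only [d <= x/y] enters on the right, each with a Mertens sum. *)
Lemma glognorm_rec x : (0 < x)%N -> 
  (glognorm x - 1) * lnn y <= glognorm (x %/ y) * (2 * (lnn x + 4)).
Proof.
move=> x0; have eqle (u w : R) : u = w -> u <= w by move=> ->.
apply: (@le_trans _ _ (\sum_(1 <= d < x.+1) cmod (g d) * lnn d / d%:R)).
  rewrite /glognorm big_ltn // [X in _ <= X]big_ltn // dirichlet_quotient1 cmod1 divr1.
  rewrite addrAC subrr add0r.
  rewrite ln1 mulr0 mul0r add0r mulr_suml; apply: ler_sum_nat => d /andP[d1 _].
  rewrite mulrAC ler_wpM2r ?invr_ge0 //.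
  case: (leqP d y) => dy; first by rewrite dirichlet_quotient_small ?d1 // cmod0 !mul0r.
  by rewrite ler_wpM2l ?cmod_ge0 // ler_ln_nat // ltnW.
pose h q := cmod (defect q).
apply: (@le_trans _ _ (\sum_(1 <= n < x.+1) \sum_(d <- divisors n)
    cmod (g d) / d%:R * h (n %/ d)%N)).
  apply: ler_sum_nat => n /andP[n0 _].
  apply: le_trans (ler_wpM2r _ (cmod_quotient_ln_le n0)) _; first by rewrite invr_ge0.
  rewrite mulr_suml !big_seq; apply: ler_sum => d; rewrite -dvdn_divisors // => dn.
  have -> : n%:R^-1 = d%:R^-1 * (n %/ d)%:R^-1 :> R.
    by rewrite -invfM -natrM mulnC divnK.
  rewrite /h /defect cmodM ger0_cmodR ?divr_ge0 ?vonMangoldt_ge0 //.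
  by move: (d%:R^-1) ((n %/ d)%:R^-1) => a b; apply: eqle; ring.
rewrite (sum_divisors_exchange (fun d m => cmod (g d) / d%:R * h m)).
have xyx : ((x %/ y).+1 <= x.+1)%N by rewrite ltnS leq_div.
rewrite (@big_cat_nat _ _ _ (x %/ y).+1) //= [X in _ + X]big_nat_cond.
rewrite [X in _ + X]big1 ?addr0.
  rewrite /glognorm mulr_suml; apply: ler_sum_nat => d /andP[d0 dxy].
  rewrite -mulr_sumr ler_wpM2l ?divr_ge0 ?cmod_ge0 //.
  have xd : (0 < x %/ d)%N.
    by rewrite divn_gt0 // -ltnS (leq_trans dxy).
  apply: le_trans (sum_cmod_defect_le xd) _.
  by rewrite ler_wpM2l // lerD2r ler_ln_nat // leq_div.
move=> d /andP[/andP[dxy dx] _]; have d0 : (0 < d)%N by exact: leq_trans dxy.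
rewrite big_nat_cond big1 // => q /andP[/andP[_ qd] _].
rewrite /h defect_small ?cmod0 ?mulr0 //.
rewrite -ltnS (leq_trans qd) // ltnS -ltnS ltn_divLR //.
by move: dxy; rewrite ltn_divLR // => /leq_trans; apply; rewrite mulnC leq_mul2r leqnSn orbT.
Qed.

Lemma ln_nat_le_expn z B : (z <= y ^ B)%N -> lnn z <= B%:R * lnn y.
Proof.
case: z => [|z] zB; first by rewrite ln0 // mulr_ge0 // ltW.
apply: le_trans (ler_ln_nat R (ltn0Sn z) zB) _.
by rewrite natrX lnXn ?ltr0n // mulr_natl.
Qed.

Lemma ln_nat_le_expnD4 z B : (z <= y ^ B)%N -> lnn z + 4 <= (B%:R + 4) * lnn y.
Proof. by move=> /ln_nat_le_expn; rewrite mulrDl; move: y2; lra. Qed.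

Lemma glognorm_le_divn B x : (0 < x <= y ^ B)%N ->
  glognorm x <= 1 + 2 * (B%:R + 4) * glognorm (x %/ y).
Proof.
move=> /andP[x0 xB]; rewrite -lerBlDl -(ler_pM2r ly0); apply: le_trans (glognorm_rec x0) _.
rewrite mulrC [X in _ <= X](_ : _ = 2 * ((B%:R + 4) * lnn y) * glognorm (x %/ y)); last ring.
by rewrite ler_wpM2r ?glognorm_ge0 // ler_wpM2l // ln_nat_le_expnD4.
Qed.

(** Each use of the recursion divides [x] by [y], so it ends after [j] steps and the bound does not
    depend on [y]. *)
Lemma glognorm_le B j x : (x <= y ^ B)%N -> (x < y ^ j.+1)%N ->
  glognorm x <= (1 + 4 * (B%:R + 4)) ^+ j.
Proof.
set k : R := _ + _; have k1 : 1 <= k.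
  by rewrite lerDl mulr_ge0 // addr_ge0.
elim: j x => [|j IH] x xB xj; have [->|x0] := posnP x.
- by rewrite /glognorm big_geq // exprn_ge0.
- have rec := @glognorm_le_divn B x; rewrite x0 in rec; apply: le_trans (rec xB) _.
  move: xj; rewrite expn1 => xj; rewrite divn_small //.
  by rewrite /glognorm big_geq // mulr0 addr0.
- by rewrite /glognorm big_geq // exprn_ge0 // (le_trans ler01).
have rec := @glognorm_le_divn B x; rewrite x0 in rec; apply: le_trans (rec xB) _.
rewrite exprS.
have xy : glognorm (x %/ y) <= k ^+ j.
  apply: IH; first exact: leq_trans (leq_div _ _) xB.
  by rewrite ltn_divLR // -expnSr.
have kj : 1 <= k ^+ j by rewrite exprn_ege1.
have B4 : 0 <= B%:R + 4 :> R by rewrite addr_ge0.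
have kE w : k * w = w + 4 * (B%:R + 4) * w by rewrite /k mulrDl mul1r.
rewrite kE; apply: lerD => //; apply: ler_pM => //; rewrite ?glognorm_ge0 ?mulr_ge0 //.
by rewrite ler_wpM2r // ler_nat.
Qed.

(** The same argument without division by [n], where Chebyshev's bound replaces that of Mertens. It
    saves a factor [ln y] over the trivial bound; [8] is [2 * 4]. *)
Lemma gnorm_le x : (0 < x)%N -> (gnorm x - 1) * lnn y <= 8 * x%:R * glognorm x.
Proof.
move=> x0.
apply: (@le_trans _ _ (\sum_(1 <= d < x.+1) cmod (g d) * lnn d)).
  rewrite /gnorm big_ltn // [X in _ <= X]big_ltn // dirichlet_quotient1 cmod1.
  rewrite addrAC subrr add0r.
  rewrite ln1 mulr0 add0r mulr_suml; apply: ler_sum_nat => d /andP[d1 _].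
  case: (leqP d y) => dy; first by rewrite dirichlet_quotient_small ?d1 // cmod0 !mul0r.
  by rewrite ler_wpM2l ?cmod_ge0 // ler_ln_nat // ltnW.
apply: (@le_trans _ _ (\sum_(1 <= n < x.+1) \sum_(d <- divisors n)
    cmod (g d) * (2 * Lambda (n %/ d)))).
  apply: ler_sum_nat => n /andP[n0 _]; apply: le_trans (cmod_quotient_ln_le n0) _.
  rewrite !big_seq; apply: ler_sum => d; rewrite -dvdn_divisors // => dn.
  rewrite ler_wpM2l ?cmod_ge0 // mulrC ler_wpM2r ?vonMangoldt_ge0 //.
  by rewrite cmod_subr1_le2 // divn_dvd_gt0.
rewrite (sum_divisors_exchange (fun d m => cmod (g d) * (2 * Lambda m))).
rewrite /glognorm mulr_sumr; apply: ler_sum_nat => d /andP[d0 _].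
rewrite -mulr_sumr mulrCA ler_wpM2l ?cmod_ge0 // -mulr_sumr.
have := chebyshev_psi_le R (x %/ d).
rewrite -(ler_pM2l (ltr0n R 2)) => /le_trans; apply.
have : (x %/ d)%:R <= x%:R / d%:R :> R.
  by rewrite ler_pdivlMr ?ltr0n // -natrM ler_nat leq_trunc_div.
by rewrite -mulrA; move: (x%:R / d%:R) (_%:R) => a b; lra.
Qed.

Definition glogsum z : C := \sum_(1 <= n < z.+1) g n / n%:R.
Definition glnsum z : C := \sum_(1 <= n < z.+1) (lnn n)%:C * (g n / n%:R).

Lemma sum_quotient_harmonic z (a : nat -> C) :
  \sum_(1 <= n < z.+1) \sum_(d <- divisors n) g d * a d * a (n %/ d)%N =
  \sum_(1 <= d < z.+1) g d * a d * \sum_(1 <= m < (z %/ d).+1) a m.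
Proof.
rewrite (sum_divisors_exchange (fun d m => g d * a d * a m)).
by apply: eq_bigr => d _; rewrite mulr_sumr.
Qed.

Lemma cmod_sum_f_le N : cmod (\sum_(1 <= n < N.+1) f n) <= N%:R * cmod (glogsum N) + gnorm N.
Proof.
have -> : \sum_(1 <= n < N.+1) f n = \sum_(1 <= d < N.+1) g d * (N %/ d)%:R.
  transitivity (\sum_(1 <= n < N.+1) \sum_(d <- divisors n) g d * 1 * 1).
    apply: eq_big_nat => n /andP[n0 _]; rewrite -gE //.
    by apply: eq_bigr => d _; rewrite !mulr1.
  rewrite (sum_quotient_harmonic N (fun=> 1)); apply: eq_bigr => d _.
  by rewrite mulr1 big_const_nat subn1 iter_addr addr0.
have -> : N%:R * cmod (glogsum N) = cmod (\sum_(1 <= d < N.+1) g d * (N%:R / d%:R)).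
  rewrite -[N%:R](ger0_cmodR (ler0n R N)) -cmodM rmorph_nat /glogsum mulr_sumr.
  by congr cmod; apply: eq_bigr => d _; rewrite mulrCA.
rewrite -[X in cmod X](subrK (\sum_(1 <= d < N.+1) g d * (N%:R / d%:R))) addrC.
apply: le_trans (cmodD _ _) _; rewrite lerD2l -sumrB.
apply: le_trans (ler_cmod_sum _ _ _) _; apply: ler_sum_nat => d /andP[d0 _].
rewrite -mulrBr cmodM ler_piMr ?cmod_ge0 //.
have -> : (N %/ d)%:R - N%:R / d%:R = ((N %/ d)%:R - N%:R / d%:R : R)%:C.
  by rewrite rmorphB rmorphM fmorphV !rmorph_nat.
rewrite cmodR.
have d0' : 0 < d%:R :> R by rewrite ltr0n.
have lo : (N %/ d)%:R <= N%:R / d%:R :> R.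
  by rewrite ler_pdivlMr // -natrM ler_nat leq_trunc_div.
have up : N%:R / d%:R <= (N %/ d)%:R + 1 :> R.
  rewrite natr1 ler_pdivrMr // -natrM ler_nat.
  by have := divn_eq N d; have := ltn_pmod N d0; nia.
by rewrite ler_norml; move: lo up; move: (N%:R / d%:R) (_%:R) => a b; lra.
Qed.

Lemma LgE z : glnsum z = - \sum_(1 <= m < z.+1) (g m / m%:R) * defect_sum (z %/ m).
Proof.
rewrite /glnsum; transitivity (- \sum_(1 <= n < z.+1) \sum_(d <- divisors n)
    (g d / d%:R) * defect (n %/ d)%N).
  rewrite -sumrN; apply: eq_big_nat => n /andP[n0 _].
  exact: dirichlet_quotient_ln_div.
rewrite (sum_divisors_exchange (fun d m => g d / d%:R * defect m)); congr (- _).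
by apply: eq_bigr => d _; rewrite mulr_sumr.
Qed.

Lemma sum_quotient_split z (F : nat -> C) : (X <= z)%N ->
  \sum_(1 <= m < z.+1) (g m / m%:R) * F m =
  F 1%N + \sum_(y.+1 <= m < X.+1) (g m / m%:R) * F m
        + \sum_(X.+1 <= m < z.+1) (g m / m%:R) * F m.
Proof.
move=> Xz; case/andP: yX => yX' _.
rewrite (@big_cat_nat _ _ _ X.+1) //=; congr (_ + _).
rewrite (@big_cat_nat _ _ _ y.+1) //=; last by rewrite ltnS ltnW.
congr (_ + _); rewrite big_ltn // dirichlet_quotient1 divr1 mul1r.
rewrite big_nat_cond big1 ?addr0 // => m /andP[/andP[m1 my] _].
by rewrite dirichlet_quotient_small ?mul0r // m1.
Qed.

Lemma divn_XyP m : (y < m)%N -> (X %/ m <= y)%N.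
Proof.
move=> ym; have m0 : (0 < m)%N by exact: leq_trans ym.
rewrite ltnW // ltn_divLR //; case/andP: yX => _ /leq_trans; apply.
by rewrite leq_mul2l ltnW ?orbT.
Qed.

Lemma glnsum_X : glnsum X = - defect_sum X.
Proof.
rewrite LgE sum_quotient_split // [X in _ + X]big_geq // addr0 divn1.
rewrite big_nat_cond big1 ?addr0 // => m /andP[/andP[ym _] _].
by rewrite defect_sum_small ?mulr0 // divn_XyP.
Qed.

(** With the summations exchanged, the inner sum for given [q] is [glogsum (z %/ q) - glogsum X],
    and [q > y] since smaller defects vanish. Thus only values of [glogsum] up to [z %/ y] occur. *)
Lemma cmod_tail_le z E : (0 < z)%N -> 0 <= E ->
  (forall z', (X <= z' <= z %/ y)%N -> cmod (glogsum z') <= E) ->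
  cmod (\sum_(X.+1 <= m < z.+1) (g m / m%:R) * defect_sum (z %/ m))
    <= 2 * E * (2 * (lnn z + 4)).
Proof.
move=> z0 E0 GE.
have -> : \sum_(X.+1 <= m < z.+1) (g m / m%:R) * defect_sum (z %/ m) =
    \sum_(1 <= q < z.+1) defect q *
      \sum_(1 <= m < (z %/ q).+1) (if (X < m)%N then g m / m%:R else 0).
  under [RHS]eq_bigr do rewrite mulr_sumr.
  rewrite -(sum_hyperbolaC (fun m q => defect q * (if (X < m)%N then g m / m%:R else 0))).
  case: (leqP X z) => Xz.
    rewrite [RHS](@big_cat_nat _ _ _ X.+1) //= [X in X + _]big_nat_cond.
    rewrite [X in X + _]big1 ?add0r.
      apply: eq_big_nat => m /andP[Xm _]; rewrite Xm -mulr_suml mulrC //.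
    move=> m /andP[/andP[_ mX] _]; rewrite big1 // => q _.
    by rewrite ltnNge -ltnS mX mulr0.
  rewrite big_geq ?ltnS 1?ltnW // big_nat_cond big1 // => m /andP[/andP[_ mz] _].
  rewrite big1 // => q _; rewrite ltnNge (leq_trans _ (ltnW Xz)) ?mulr0 //.
apply: le_trans (ler_cmod_sum _ _ _) _.
apply: (@le_trans _ _ (\sum_(1 <= q < z.+1) 2 * E * cmod (defect q))); last first.
  by rewrite -mulr_sumr ler_wpM2l ?mulr_ge0 // sum_cmod_defect_le.
apply: ler_sum_nat => q /andP[q0 _]; rewrite cmodM mulrC.
case: (leqP q y) => qy; first by rewrite defect_small // cmod0 !mulr0.
rewrite ler_wpM2r ?cmod_ge0 //.
case: (leqP X (z %/ q)) => Xz; last first.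
  rewrite big_nat_cond big1 ?cmod0 ?mulr_ge0 // => m /andP[/andP[_ mz] _].
  by rewrite ltnNge (leq_trans _ (ltnW Xz)).
have zq : (z %/ q <= z %/ y)%N by rewrite leq_div2l // ltnW.
have -> : \sum_(1 <= m < (z %/ q).+1) (if (X < m)%N then g m / m%:R else 0) =
    glogsum (z %/ q) - glogsum X.
  rewrite /glogsum -sum_nat_subr // (@big_cat_nat _ _ _ X.+1) //= big_nat_cond big1 ?add0r.
    by apply: eq_big_nat => m /andP[-> _].
  by move=> m /andP[/andP[_ mX] _]; rewrite ltnNge -ltnS mX.
apply: le_trans (cmodB _ _) _; rewrite mulrDl mul1r.
by apply: lerD; apply: GE; rewrite ?Xz ?zq // leqnn (leq_trans Xz).
Qed.

(** What remains of [glnsum X - glnsum z] without the terms [m > X]. *)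
Definition renewal_defect z :=
  defect_sum z - defect_sum X + \sum_(y.+1 <= m < X.+1) (g m / m%:R) * defect_sum (z %/ m).

Lemma cmod_glnsum_sub_le z K E : (X <= z)%N -> 0 <= E -> cmod (renewal_defect z) <= K ->
  (forall z', (X <= z' <= z %/ y)%N -> cmod (glogsum z') <= E) ->
  cmod (glnsum z - glnsum X) <= K + 2 * E * (2 * (lnn z + 4)).
Proof.
move=> Xz E0 TK GE.
have z0 : (0 < z)%N by case/andP: yX => /leq_trans/(_ Xz)/(leq_trans _) H _; exact: H.
rewrite glnsum_X LgE sum_quotient_split // divn1.
rewrite -cmodN [X in cmod X](_ : _ = renewal_defect z +
    \sum_(X.+1 <= m < z.+1) (g m / m%:R) * defect_sum (z %/ m)); last first.
  by rewrite /renewal_defect; ring.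
apply: le_trans (cmodD _ _) (lerD TK _).
exact: cmod_tail_le.
Qed.

Lemma cmod_glogsum_sub_le z K : (X <= z)%N ->
  (forall z', (X <= z' <= z)%N -> cmod (glnsum z' - glnsum X) <= K) ->
  cmod (glogsum z - glogsum X) <= K / lnn y.
Proof.
move=> Xz LK; case/andP: yX => yX' _; have X1 := ltn_trans y1 yX'.
have K0 : 0 <= K by apply: le_trans (LK X _); rewrite ?cmod_ge0 ?leqnn.
rewrite /glogsum -sum_nat_subr //.
have -> : \sum_(X.+1 <= n < z.+1) g n / n%:R =
    \sum_(X.+1 <= n < z.+1) ((lnn n)^-1)%:C * ((lnn n)%:C * (g n / n%:R)).
  apply: eq_big_nat => n /andP[Xn _]; rewrite mulrA -rmorphM mulVf ?rmorph1 ?mul1r //.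
  by rewrite gt_eqF // ln_nat_gt0 // (ltn_trans X1).
apply: (@le_trans _ _ (K * (lnn X.+1)^-1)).
  apply: (@abel_summation _ (fun n => (lnn n)%:C * (g n / n%:R)) (fun n => (lnn n)^-1)) => //.
    move=> [//|k] /andP[Xk kz]; rewrite sum_nat_subr //.
    by apply: LK; rewrite -ltnS Xk.
  by move=> i Xi; apply: inv_ln_nat_noninc; rewrite (ltn_trans X1).
rewrite ler_wpM2l // lef_pV2 ?posrE ?ln_nat_gt0 //; last exact: ltnW.
by rewrite ler_ln_nat // (leq_trans (ltnW yX')).
Qed.

(** Induction on [j]: for [z] in one range, the tail involves only the previous range. The tail
    costs a factor of order [ln y], which passing from [glnsum] to [glogsum] by partial summation
    gains back, so each step multiplies the bound by a constant independent of [y]. *)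
Lemma cmod_glogsum_le B K j z :
  (forall z', (X <= z' <= y ^ B)%N -> cmod (renewal_defect z') <= K) ->
  (X <= z <= y ^ B)%N -> (z < X * y ^ j)%N ->
  cmod (glogsum z) <= (cmod (glogsum X) + K / lnn y) * (1 + 4 * (B%:R + 4)) ^+ j.
Proof.
move=> TK; set D := cmod (glogsum X) + _; set k : R := 1 + _.
elim: j z => [|j IH] z /andP[Xz zB] zj.
  by move: zj; rewrite expn0 muln1 ltnNge Xz.
have K0 : 0 <= K.
  apply: le_trans (TK X _); rewrite ?cmod_ge0 // leqnn /=.
  exact: leq_trans zB.
have B4 : 0 <= B%:R + 4 :> R by rewrite addr_ge0.
have k1 : 1 <= k by rewrite lerDl mulr_ge0.
have D0 : 0 <= D by rewrite addr_ge0 ?cmod_ge0 // divr_ge0 // ltW.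
pose E := D * k ^+ j; have E0 : 0 <= E by rewrite mulr_ge0 // exprn_ge0 // (le_trans ler01).
have L z' : (X <= z' <= z)%N ->
    cmod (glnsum z' - glnsum X) <= K + 2 * E * (2 * ((B%:R + 4) * lnn y)).
  move=> /andP[Xz' z'z]; have z'B := leq_trans z'z zB.
  apply: le_trans (cmod_glnsum_sub_le Xz' E0 (TK _ _) _) _; first by rewrite Xz'.
    move=> w /andP[Xw wz]; apply: IH; rewrite ?Xw /=.
      exact: leq_trans wz (leq_trans (leq_div _ _) z'B).
    apply: leq_ltn_trans wz _; rewrite ltn_divLR // -mulnA -expnSr.
    exact: leq_ltn_trans zj.
  rewrite lerD2l; apply: ler_wpM2l; first by rewrite mulr_ge0.
  by apply: ler_wpM2l => //; exact: ln_nat_le_expnD4.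
have := cmod_glogsum_sub_le Xz L => H.
rewrite -[glogsum z](subrK (glogsum X)); apply: le_trans (cmodD _ _) _.
apply: le_trans (lerD H (lexx _)) _.
have -> : (K + 2 * E * (2 * ((B%:R + 4) * lnn y))) / lnn y + cmod (glogsum X) =
    D + 4 * (B%:R + 4) * E.
  by rewrite /D; field; rewrite gt_eqF.
have kE w : k * w = w + 4 * (B%:R + 4) * w by rewrite /k mulrDl mul1r.
have -> : D * k ^+ j.+1 = k * E by rewrite exprS /E mulrCA.
by rewrite kE lerD2r /E ler_peMr // exprn_ege1.
Qed.

Lemma cmod_sum_f_bound B K N :
  (forall z', (X <= z' <= y ^ B)%N -> cmod (renewal_defect z') <= K) ->
  (X <= N <= y ^ B)%N ->
  cmod (\sum_(1 <= n < N.+1) f n) <=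
    (cmod (glogsum X) + (K + 9) / lnn y) * (1 + 4 * (B%:R + 4)) ^+ B * N%:R.
Proof.
move=> TK /andP[XN NB]; case/andP: (yX) => yX' _.
have N0 : (0 < N)%N by exact: leq_trans (leq_trans _ yX') XN.
have NBj : (N < y ^ B.+1)%N.
  by rewrite (leq_ltn_trans NB) // ltn_exp2l.
set k : R := 1 + _.
have k1 : 1 <= k by rewrite lerDl mulr_ge0 // addr_ge0.
have kB : 1 <= k ^+ B by rewrite exprn_ege1.
have G : cmod (glogsum N) <= (cmod (glogsum X) + K / lnn y) * k ^+ B.
  apply: cmod_glogsum_le => //; first by rewrite XN.
  rewrite (leq_trans NBj) // expnS leq_mul2r (ltnW yX') orbT //.
(* [9] is the [8] of [gnorm_le] plus [1] for the term [d = 1], absorbed by [ln y <= N]. *)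
have Q : gnorm N <= 9 / lnn y * k ^+ B * N%:R.
  have lN : lnn y <= N%:R.
    apply: le_trans (ln_nat_le R N); apply: ler_ln_nat => //.
    exact: leq_trans (ltnW yX') XN.
  have h := glognorm_le NB NBj; have := gnorm_le N0.
  have -> : 9 / lnn y * k ^+ B * N%:R = 9 * k ^+ B * N%:R / lnn y by ring.
  rewrite ler_pdivlMr // mulrBl mul1r => H.
  have : 8 * N%:R * glognorm N <= 8 * N%:R * k ^+ B by rewrite ler_wpM2l // mulr_ge0.
  have : N%:R <= k ^+ B * N%:R by rewrite ler_peMl.
  by move: lN H; move: (glognorm N) (k ^+ B) (gnorm N * _) (N%:R) => a b c d; lra.
apply: le_trans (cmod_sum_f_le N) _.
have NG := ler_wpM2l (ler0n R N) G.
apply: le_trans (lerD NG Q) _.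
by rewrite le_eqVlt; apply/orP; left; apply/eqP; field; rewrite gt_eqF.
Qed.

End QuotientBounds.

(** * The extremal function *)

Section Construction.
Variable R : realType.
Local Notation C := R[i].
Local Notation cmod := (@ComplexField.Normc.normc R).
Local Notation "x %:C" := (real_complex R x).
Local Notation Lambda := (@vonMangoldt R).
Local Notation lnn n := (ln (n%:R : R)).
Local Notation pw := (@prime_weight R).
Local Notation iv := (@prime_inv R).
Local Notation I := (Complex 0 1 : C).
Variables (c sg : R) (y X : nat) (e s : nat -> bool).
Hypothesis c12 : 1 <= c <= 2.
Hypothesis c_sg : (1 - c) ^+ 2 + sg ^+ 2 = 1.
Hypothesis y21 : 21 <= lnn y.
Hypothesis yX : (y < X < y * y)%N.
Let W := \sum_(y.+1 <= q < X.+1) iv q.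
Hypothesis W_c : `|W - c^-1| <= 10 / lnn y.
Let t z := \sum_(1 <= n < z.+1) (e n)%:R * pw n.
Hypothesis e_small : forall n, (n <= y)%N -> e n = false.
Hypothesis e_middle : forall n, (y < n <= X)%N -> e n = true.
Hypothesis t_greedy : forall z, (X <= z)%N ->
  `|t z - (t X + \sum_(y.+1 <= q < X.+1) iv q / W * t (z %/ q)%N)| <= 17.
Hypothesis s_balanced : forall N,
  `|\sum_(1 <= n < N.+1) (-1) ^+ s n * ((e n)%:R * pw n)| <= 1.
Implicit Types (m n p q z N B : nat).

(** Selected primes get xi or its conjugate according to [s]. Both have real part [1 - c], so [s]
    affects only imaginary parts. *)
Definition prime_value p : C := if e p then Complex (1 - c) ((-1) ^+ s p * sg) else 1.
Definition extremal : nat -> C := cmul_extension prime_value.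
Variable g : nat -> C.
Hypothesis gE : forall n, (0 < n)%N -> \sum_(d <- divisors n) g d = extremal n.

Let y2 : 1 <= lnn y. Proof. by move: y21; lra. Qed.
Let ly0 : 0 < lnn y. Proof. by move: y21; lra. Qed.
Let yX' : (y < X)%N. Proof. by case/andP: yX. Qed.
Let y1 : (1 < y)%N.
Proof.
rewrite ltnNge; apply/negP => y1.
have : lnn y <= 0 by apply: ln_le0; rewrite lern1.
by move: y2; lra.
Qed.
Let c0 : 0 < c. Proof. by case/andP: c12; lra. Qed.

Let W_sub : `|1 - c * W| <= 20 / lnn y.
Proof.
have -> : 1 - c * W = - (c * (W - c^-1)) by field; rewrite gt_eqF.
rewrite normrN normrM gtr0_norm // -[20]/((2 * 10)%:R) natrM -mulrA.
by apply: ler_pM => //; [exact: ltW | case/andP: c12].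
Qed.

Let invly : (lnn y)^-1 <= 21^-1. Proof. by rewrite lef_pV2 ?posrE. Qed.

Let W_le : W <= 2.
Proof.
have : c^-1 <= 1 by rewrite invf_le1 //; case/andP: c12.
by move: W_c invly; rewrite ler_norml; move: ((lnn y)^-1) => a; lra.
Qed.

(** The threshold [21] for [ln y] is tuned to this: [10/21 < 1/2 <= 1/c]. *)
Let W_gt0 : 0 < W.
Proof.
have : 2^-1 <= c^-1 by rewrite lef_pV2 ?posrE //; case/andP: c12.
by move: W_c invly; rewrite ler_norml; move: ((lnn y)^-1) => a; lra.
Qed.

Let sg1 : `|sg| <= 1.
Proof.
rewrite -(@ler_pXn2r _ 2) ?nnegrE // expr1n real_normK ?num_real //.
by have := sqr_ge0 (1 - c); move: c_sg; lra.
Qed.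

Lemma sign_sqr (b : bool) : ((-1) ^+ b) ^+ 2 = 1 :> R.
Proof. by case: b; rewrite ?expr1 ?expr0 ?sqrrN expr1n. Qed.

Lemma cmod_prime_value p : cmod (prime_value p) = 1.
Proof.
rewrite /prime_value; case: (e p); last exact: cmod1.
by rewrite /= exprMn sign_sqr mul1r c_sg sqrtr1.
Qed.

Lemma extremal_completely_multiplicative : completely_multiplicative extremal.
Proof. exact: cmul_extension_completely_multiplicative. Qed.

Lemma extremal_prime p : prime p -> extremal p = prime_value p.
Proof. exact: cmul_extension_prime. Qed.

Let f_le1 n : (0 < n)%N -> cmod (extremal n) <= 1.
Proof. by move=> _; rewrite cmod_cmul_extension //; exact: cmod_prime_value. Qed.

Let f_small n : (0 < n <= y)%N -> extremal n = 1.
Proof. by apply: cmul_extension_eq1 => p py; rewrite /prime_value e_small. Qed.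

Let fM := extremal_completely_multiplicative.

Lemma one_sub_prime_value p :
  1 - prime_value p = (c * (e p)%:R)%:C - (sg * ((-1) ^+ s p * (e p)%:R))%:C * I.
Proof.
apply/eqP; rewrite /prime_value eq_complex; case: (e p) => /=; apply/andP; split; apply/eqP.
all: by rewrite ?mulr1 ?mulr0 ?mul0r ?subr0 ?add0r; ring.
Qed.

Let cmodI : cmod I = 1.
Proof. by rewrite /= expr0n add0r expr1n sqrtr1. Qed.

Let r z : C := defect_sum extremal z - (c * t z)%:C.

(** Two parts of [T] are bounded: the imaginary parts at primes, by [1] thanks to the signs, and the
    proper prime powers, by [2 * 2]. *)
Lemma cmod_r_le z : cmod (r z) <= 5.
Proof.
have -> : r z = - (sg * \sum_(1 <= n < z.+1) (-1) ^+ s n * ((e n)%:R * pw n))%:C * I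
    + \sum_(1 <= q < z.+1 | ~~ prime q) defect extremal q.
  rewrite /r /defect_sum (bigID prime) /= addrAC; congr (_ + _).
  rewrite /t !mulr_sumr !rmorph_sum /= big_mkcond mulNr mulr_suml -!sumrB -sumrN.
  apply: eq_bigr => n _; case: ifP => [pn|npn].
    rewrite /defect extremal_prime // one_sub_prime_value vonMangoldt_prime //.
    rewrite /prime_weight pn.
    by rewrite !rmorphM /=; ring.
  by rewrite /prime_weight npn !mulr0 rmorph0 mul0r subrr oppr0.
apply: le_trans (cmodD _ _) _; rewrite -[5]/((1 + 4)%:R) natrD; apply: lerD.
  rewrite cmodM cmodI mulr1 cmodN cmodR normrM.
  rewrite -[X in _ <= X]mulr1; apply: ler_pM => //; exact: s_balanced.
apply: le_trans (ler_cmod_sum _ _ _) _.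
apply: le_trans (ler_sum _ (fun q _ => cmod_defect_le f_le1 f_small q)) _.
rewrite -mulr_sumr -[4]/((2 * 2)%:R) natrM ler_wpM2l //.
exact: sum_vonMangoldt_nonprime_le.
Qed.

Lemma quotient_middle m : (y < m <= X)%N ->
  g m / m%:R = (iv m)%:C * ((sg * (-1) ^+ s m)%:C * I - c%:C).
Proof.
move=> ym; rewrite (dirichlet_quotient_middle fM f_small gE y2 yX ym) /prime_inv.
case: ifP => pm; last by rewrite rmorph0 !mul0r.
rewrite extremal_prime // -[prime_value m - 1]opprB one_sub_prime_value e_middle // !mulr1.
rewrite invn_natC; ring.
Qed.

Lemma cmod_quotient_middle m : (y < m <= X)%N -> cmod (g m / m%:R) <= 2 * iv m.
Proof.
move=> ym; rewrite (dirichlet_quotient_middle fM f_small gE y2 yX ym) /prime_inv.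
case: ifP => pm; last by rewrite mul0r cmod0 mulr0.
rewrite cmodM cmod_natV ler_wpM2r ?invr_ge0 //.
rewrite -cmodN opprB; apply: cmod_subr1_le2 => //.
exact: prime_gt0.
Qed.

Let pw_e n : 0 <= (e n)%:R * pw n <= pw n.
Proof. by case: (e n); rewrite ?mul1r ?mul0r ?lexx prime_weight_ge0. Qed.

Lemma t_ge0 z : 0 <= t z.
Proof. by apply: sumr_ge0 => n _; case/andP: (pw_e n). Qed.

Lemma t_mono z z' : (z <= z')%N -> t z <= t z'.
Proof.
move=> zz; rewrite /t [X in _ <= X](@big_cat_nat _ _ _ z.+1) //= lerDl.
by apply: sumr_ge0 => n _; case/andP: (pw_e n).
Qed.

Lemma t_le B z : (0 < z)%N -> (z <= y ^ B)%N -> t z <= (B%:R + 4) * lnn y.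
Proof.
move=> z0 zB; apply: le_trans (ln_nat_le_expnD4 y2 zB).
apply: (@le_trans _ _ (\sum_(1 <= n < z.+1) pw n)).
  by apply: ler_sum => n _; case/andP: (pw_e n).
by have := mertens_prime R z0; rewrite ler_norml; lra.
Qed.

Let sign_sum_middle k : (y.+1 <= k <= X.+1)%N ->
  `|\sum_(y.+1 <= m < k) (-1) ^+ s m * pw m| <= 2.
Proof.
case: k => // k /andP[yk kX].
have -> : \sum_(y.+1 <= m < k.+1) (-1) ^+ s m * pw m =
    \sum_(y.+1 <= m < k.+1) (-1) ^+ s m * ((e m)%:R * pw m).
  apply: eq_big_nat => m /andP[ym mk]; rewrite e_middle ?mul1r // ym.
  by rewrite -ltnS (leq_trans mk).
rewrite sum_nat_subr //; apply: le_trans (ler_normB _ _) _.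
by have := lerD (s_balanced k) (s_balanced y).
Qed.

(** The signs balance the weights [ln p / p]; Abel summation transfers this to [b p / p] for
    nonincreasing [b] and gains [1 / ln y]. *)
Lemma sign_sum_twisted (b : nat -> R) :
  (forall i, (y < i)%N -> 0 <= b i.+1 <= b i) ->
  `|\sum_(y.+1 <= m < X.+1) iv m * (-1) ^+ s m * b m| <= 2 * ((lnn y)^-1 * b y.+1).
Proof.
move=> bP.
have b0 i : (y < i)%N -> 0 <= b i by move=> /bP/andP[/le_trans]; exact.
have -> : \sum_(y.+1 <= m < X.+1) iv m * (-1) ^+ s m * b m =
    \sum_(y.+1 <= m < X.+1) ((lnn m)^-1 * b m) * ((-1) ^+ s m * pw m).
  apply: eq_big_nat => m /andP[ym _].
  by rewrite prime_invE ?(ltn_trans y1) //; ring.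
apply: (@le_trans _ _ (2 * ((lnn y.+1)^-1 * b y.+1))).
  apply: (@abel_summationR _ (fun m => (-1) ^+ s m * pw m) (fun m => (lnn m)^-1 * b m)).
  - by rewrite ltnS ltnW.
  - exact: sign_sum_middle.
  - move=> i yi; have /andP[b1 b2] := bP i yi.
    have /andP[l1 l2] := @inv_ln_nat_noninc R i (ltn_trans y1 yi).
    by rewrite mulr_ge0 // ler_pM.
rewrite ler_wpM2l // ler_wpM2r ?b0 //.
by have /andP[] := @inv_ln_nat_noninc R y y1.
Qed.

Lemma cmod_glogsum_X : cmod (glogsum g X) <= 22 / lnn y.
Proof.
have -> : glogsum g X = (1 - c * W)%:C +
    (sg * \sum_(y.+1 <= m < X.+1) iv m * (-1) ^+ s m * 1)%:C * I.
  have := @sum_quotient_split _ _ _ _ _ fM f_small gE y2 yX X (fun=> 1) (leqnn X).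
  rewrite [X in _ = _ + X]big_geq // addr0.
  under eq_bigr do rewrite mulr1.
  rewrite -/(glogsum g X) => ->; under eq_bigr do rewrite mulr1.
  rewrite rmorphB rmorph1 -addrA; congr (_ + _).
  rewrite /W !mulr_sumr !rmorph_sum /= mulr_suml -sumrN -big_split /=.
  apply: eq_big_nat => m ym; rewrite quotient_middle //.
  by rewrite !rmorphM rmorph1 /=; ring.
apply: le_trans (cmodD _ _) _; rewrite -[22]/((20 + 2)%:R) natrD mulrDl; apply: lerD.
  by rewrite cmodR.
rewrite cmodM cmodI mulr1 cmodR normrM.
have := @sign_sum_twisted (fun=> 1); rewrite mulr1 => H.
rewrite -[X in _ <= X]mul1r; apply: ler_pM => //; apply: H => i _.
by rewrite ler01 lexx.
Qed.

(** The four error sources: the greedy selection, the replacement of [1/W] by [c], the imaginary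
    parts of [g], and the bounded remainder [r]. *)
Lemma renewal_defect_decomposition z :
  renewal_defect extremal g y X z =
    (c * (t z - (t X + \sum_(y.+1 <= q < X.+1) iv q / W * t (z %/ q)%N)))%:C
  + (c * ((W^-1 - c) * \sum_(y.+1 <= q < X.+1) iv q * t (z %/ q)%N))%:C
  + (c * sg * \sum_(y.+1 <= q < X.+1) iv q * (-1) ^+ s q * t (z %/ q)%N)%:C * I
  + (r z - r X + \sum_(y.+1 <= q < X.+1) (g q / q%:R) * r (z %/ q)%N).
Proof.
have TE w : defect_sum extremal w = (c * t w)%:C + r w by rewrite /r addrC subrK.
rewrite /renewal_defect !TE.
have -> : \sum_(y.+1 <= m < X.+1) g m / m%:R * defect_sum extremal (z %/ m)%N =
   \sum_(y.+1 <= m < X.+1) (g m / m%:R) * r (z %/ m)%N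
   - (c * c * \sum_(y.+1 <= q < X.+1) iv q * t (z %/ q)%N)%:C
   + (c * sg * \sum_(y.+1 <= q < X.+1) iv q * (-1) ^+ s q * t (z %/ q)%N)%:C * I.
  rewrite !mulr_sumr !rmorph_sum /= mulr_suml -sumrB -big_split /=.
  apply: eq_big_nat => m ym; rewrite TE quotient_middle //.
  by rewrite !rmorphM /=; move: (r _) => w; ring.
have -> : \sum_(y.+1 <= q < X.+1) iv q / W * t (z %/ q)%N =
    W^-1 * \sum_(y.+1 <= q < X.+1) iv q * t (z %/ q)%N.
  by rewrite mulr_sumr; apply: eq_bigr => q _; ring.
move: (\sum_(_ <= _ < _) (_ * r _)) => S1.
move: (\sum_(_ <= _ < _) _) (\sum_(_ <= _ < _) _) => S2 S3.
rewrite !(rmorphM, rmorphB, rmorphD) /=; ring.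
Qed.

Lemma cmod_renewal_defect_le B z : (X <= z <= y ^ B)%N ->
  cmod (renewal_defect extremal g y X z) <= 64 + 44 * (B%:R + 4).
Proof.
move=> /andP[Xz zB]; have z0 : (0 < z)%N by exact: leq_trans (leq_trans _ yX') Xz.
have tz := t_le z0 zB; case/andP: c12 => c1 c2.
have B4 : 0 <= B%:R + 4 :> R by rewrite addr_ge0.
have tzq q : t (z %/ q)%N <= t z by apply: t_mono; exact: leq_div.
rewrite renewal_defect_decomposition.
have A1 : cmod (c * (t z - (t X + \sum_(y.+1 <= q < X.+1) iv q / W * t (z %/ q)%N)))%:C <= 34.
  rewrite cmodR normrM gtr0_norm // -[34]/((2 * 17)%:R) natrM.
  by apply: ler_pM => //; [exact: ltW | exact: t_greedy].
(* [t] may be of order [ln y], but [1 - c * W] is of order [1 / ln y]. *)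
have A2 : cmod (c * ((W^-1 - c) * \sum_(y.+1 <= q < X.+1) iv q * t (z %/ q)%N))%:C
    <= 40 * (B%:R + 4).
  have S0 : 0 <= \sum_(y.+1 <= q < X.+1) iv q * t (z %/ q)%N.
    by apply: sumr_ge0 => q _; rewrite mulr_ge0 ?prime_inv_ge0 ?t_ge0.
  have S1 : \sum_(y.+1 <= q < X.+1) iv q * t (z %/ q)%N <= W * ((B%:R + 4) * lnn y).
    rewrite /W mulr_suml; apply: ler_sum => q _.
    by rewrite ler_wpM2l ?prime_inv_ge0 // (le_trans (tzq q)).
  rewrite cmodR normrM gtr0_norm // normrM (ger0_norm S0).
  have -> : 40 * (B%:R + 4) = 2 * (20 / lnn y * ((B%:R + 4) * lnn y)).
    by field; rewrite gt_eqF.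
  apply: ler_pM => //; [exact: ltW | by rewrite mulr_ge0 |].
  apply: le_trans (ler_wpM2l (normr_ge0 _) S1) _.
  rewrite [X in X <= _](_ : _ = `|1 - c * W| * ((B%:R + 4) * lnn y)).
    by apply: ler_wpM2r W_sub; rewrite mulr_ge0 // ltW.
  have -> : 1 - c * W = (W^-1 - c) * W by rewrite mulrBl mulVf ?gt_eqF.
  by rewrite normrM (gtr0_norm W_gt0) !mulrA.
(* Since [t (z %/ q)] is nonincreasing in [q], the balanced signs again offset the size [ln y] of
   [t]. *)
have A3 : cmod ((c * sg * \sum_(y.+1 <= q < X.+1) iv q * (-1) ^+ s q * t (z %/ q)%N)%:C * I)
    <= 4 * (B%:R + 4).
  rewrite cmodM cmodI mulr1 cmodR normrM.
  have := @sign_sum_twisted (fun q => t (z %/ q)%N).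
  have -> : 4 * (B%:R + 4) = 2 * (2 * ((lnn y)^-1 * ((B%:R + 4) * lnn y))).
    by field; rewrite gt_eqF.
  move=> H; apply: ler_pM => //.
    rewrite normrM gtr0_norm // -[X in _ <= X]mulr1.
    by apply: ler_pM => //; exact: ltW.
  apply: le_trans (H _) _.
    by move=> i yi; rewrite t_ge0 t_mono // leq_div2l // (ltn_trans _ yi) // ltnW.
  rewrite ler_wpM2l // ler_wpM2l ?invr_ge0 ?(ltW ly0) //.
  exact: le_trans (tzq _) tz.
have A4 : cmod (r z - r X + \sum_(y.+1 <= q < X.+1) (g q / q%:R) * r (z %/ q)%N) <= 30.
  apply: le_trans (cmodD _ _) _.
  have S1 : cmod (r z - r X) <= 10.
    apply: le_trans (cmodB _ _) _.
    by have := lerD (cmod_r_le z) (cmod_r_le X); lra.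
  have S2 : cmod (\sum_(y.+1 <= q < X.+1) (g q / q%:R) * r (z %/ q)%N) <= 10 * W.
    apply: le_trans (ler_cmod_sum _ _ _) _; rewrite /W mulr_sumr.
    apply: ler_sum_nat => q yq; rewrite cmodM -[10]/((2 * 5)%:R) natrM mulrAC.
    apply: ler_pM; rewrite ?cmod_ge0 ?cmod_quotient_middle //.
    exact: cmod_r_le.
  by move: S1 S2 W_le; lra.
apply: le_trans (cmodD _ _) _.
apply: le_trans (lerD (cmodD _ _) A4) _.
apply: le_trans (lerD (lerD (cmodD _ _) A3) (lexx _)) _.
by move: A1 A2; move: (cmod _) (cmod _) => a b; lra.
Qed.

Lemma cmod_sum_extremal_le B N : (X <= N <= y ^ B)%N ->
  cmod (\sum_(1 <= n < N.+1) extremal n) <=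
    (95 + 44 * (B%:R + 4)) * (1 + 4 * (B%:R + 4)) ^+ B / lnn y * N%:R.
Proof.
move=> XN.
apply: le_trans (cmod_sum_f_bound fM f_le1 f_small gE y2 yX (@cmod_renewal_defect_le B) XN) _.
apply: ler_wpM2r => //; rewrite [X in _ <= X]mulrAC; apply: ler_wpM2r.
  by rewrite exprn_ge0 // addr_ge0 // mulr_ge0 // addr_ge0.
have := cmod_glogsum_X; move: (cmod _) => a H.
have -> : (95 + 44 * (B%:R + 4)) / lnn y =
    22 / lnn y + (64 + 44 * (B%:R + 4) + 9) / lnn y by ring.
by rewrite lerD2r.
Qed.

(** The sum equals that of [(g d / d) H (X/d)] with harmonic sums [H]. Its real part is about
    [ln X - c * sum_q (ln X - ln q) / q]; as [c * W] is nearly [1], what is left is [c] times the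
    sum of [ln q / q]. The loss [60] is [40] from [1 - c * W], [16] from Mertens and [4] from the
    harmonic sums. *)
Lemma cmod_log_sum_extremal_ge :
  c * (lnn X - lnn y) - 60 <= cmod (\sum_(1 <= n < X.+1) extremal n / n%:R).
Proof.
have [c1 c2] := andP c12.
have X1 : (0 < X)%N by exact: leq_trans yX'.
pose H N : R := \sum_(1 <= n < N.+1) n%:R^-1.
have HE N : \sum_(1 <= m < N.+1) (m%:R^-1 : C) = (H N)%:C.
  by rewrite /H rmorph_sum; apply: eq_bigr => m _; rewrite invn_natC.
have -> : \sum_(1 <= n < X.+1) extremal n / n%:R =
    \sum_(1 <= d < X.+1) g d / d%:R * (H (X %/ d)%N)%:C.
  transitivity (\sum_(1 <= n < X.+1) \sum_(d <- divisors n) g d / d%:R * (n %/ d)%:R^-1).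
    apply: eq_big_nat => n /andP[n0 _]; rewrite -gE // mulr_suml !big_seq.
    apply: eq_bigr => d; rewrite -dvdn_divisors // => dn.
    by rewrite -mulrA -invfM -natrM [(d * _)%N]mulnC divnK.
  rewrite (sum_quotient_harmonic g X (fun d => d%:R^-1)).
  by apply: eq_bigr => d _; rewrite HE.
rewrite (sum_quotient_split fM f_small gE y2 yX (fun d => (H (X %/ d)%N)%:C) (leqnn X)).
rewrite [X in cmod (_ + X)]big_geq // addr0 divn1.
have ReD (a b : C) : complex.Re (a + b) = complex.Re a + complex.Re b.
  by case: a b => ? ? [? ?].
apply: le_trans (Re_le_cmod _); rewrite ReD Re_sum.
have -> : \sum_(y.+1 <= d < X.+1) complex.Re (g d / d%:R * (H (X %/ d)%N)%:C) =
    - (c * \sum_(y.+1 <= d < X.+1) iv d * H (X %/ d)%N).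
  rewrite mulr_sumr -sumrN; apply: eq_big_nat => d yd.
  rewrite quotient_middle // [_ * (H _)%:C]mulrC !Re_realM /=.
  by rewrite !mul0r !mulr0 !subr0 !sub0r; ring.
have H1 : lnn X <= H X.
  by apply: le_trans (harmonic_ge R X); rewrite ler_ln_nat.
have H2 : \sum_(y.+1 <= d < X.+1) iv d * H (X %/ d)%N <=
    (lnn X + 1) * W - \sum_(y.+1 <= d < X.+1) pw d.
  rewrite /W mulr_sumr -sumrB; apply: ler_sum_nat => d /andP[yd dX].
  have -> : (lnn X + 1) * iv d - pw d = iv d * (lnn X + 1 - lnn d).
    by rewrite prime_weightE; ring.
  apply: ler_wpM2l; first exact: prime_inv_ge0.
  apply: le_trans (harmonic_le R _) _.
  have dX0 : (0 < d <= X)%N by rewrite (leq_trans _ yd).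
  by have := ln_divn_le R dX0; move: (lnn (X %/ d)) => a; lra.
have y0X : (0 < y <= X)%N by rewrite (ltnW y1) ltnW.
have := @mertens_prime_interval R _ _ y0X; rewrite ler_norml => /andP[M1 _].
have lX : lnn X <= 2 * lnn y.
  have yy : (X <= y * y)%N by apply: ltnW; case/andP: yX.
  apply: le_trans (ler_ln_nat R X1 yy) _.
  have y0 : 0 < y%:R :> R by rewrite ltr0n ltnW.
  by rewrite natrM lnM ?posrE //; lra.
have E1 : - 40 <= lnn X * (1 - c * W).
  have : `|lnn X * (1 - c * W)| <= 40.
    rewrite normrM (ger0_norm (ln_nat_ge0 R X)).
    have -> : 40 = 2 * lnn y * (20 / lnn y) by field; rewrite gt_eqF.
    by apply: ler_pM => //; exact: ln_nat_ge0.
  by rewrite ler_norml => /andP[].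
have E2 := ler_wpM2l (ltW c0) H2.
have E3 := ler_wpM2l (ltW c0) M1.
have E4 : c * W <= 4.
  rewrite -[4]/((2 * 2)%:R) natrM; apply: ler_pM => //; exact: ltW.
move: E1 E2 E3 E4 H1; move: (\sum_(_ <= _ < _) _) (\sum_(_ <= _ < _) _) => S1 S2.
by move: (H X) W (lnn X) (lnn y) => hX w lX' ly' /=; lra.
Qed.

End Construction.

(** * The limits defining gamma *)

Section Gamma.
Local Open Scope classical_set_scope.
Variable R : realType.
Implicit Types (S : set R[i]) (eps X A : R).

Lemma log_mean_ge0 (f : nat -> R[i]) X : 1 <= X -> 0 <= log_mean f X.
Proof.
move=> X1; rewrite /log_mean mulr_ge0 ?invr_ge0 ?ln_ge0 //.
by case: (sum_upto _ _) => a b /=; rewrite sqrtr_ge0.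
Qed.

Lemma esup_or0_log_means_ge0 S eps X A : 1 <= X ->
  (0 <= esup_or0 (log_means S eps X A))%E.
Proof.
move=> X1; rewrite /esup_or0; case: eqP => // /eqP/set0P[_ [f fS _]].
apply: le_ereal_sup_tmp; exists (log_mean f X)%:E; first by exists f.
by rewrite lee_fin log_mean_ge0.
Qed.

(** [1 <= X] makes logarithmic means nonnegative, so the value [0] of an empty supremum respects the
    order, and makes [X^A] nondecreasing in [A]. *)
Lemma esup_or0_log_means_le S S' eps eps' X A A' : 1 <= X ->
  S `<=` S' -> eps <= eps' -> A' <= A ->
  (esup_or0 (log_means S eps X A) <= esup_or0 (log_means S' eps' X A'))%E.
Proof.
move=> X1 SS ee AA.
rewrite {1}/esup_or0; case: eqP => [_|/eqP/set0P[_ [f fS _]]].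
  exact: esup_or0_log_means_ge0.
have sub : log_means S eps X A `<=` log_means S' eps' X A'.
  move=> _ [g [[gm gS] gsmall] <-]; exists g => //; split.
    by split => // p pp; apply: SS; exact: gS.
  move=> x Xx xXA; apply: le_trans (gsmall x Xx _) _.
    by apply: le_trans xXA _; apply: ler_powR.
  by rewrite ler_wpM2r // (le_trans _ Xx) // (le_trans _ X1).
rewrite /esup_or0; case: eqP => [E|_]; last exact: ereal_sup_le.
exfalso; have : log_means S' eps' X A' (log_mean f X)%:E by apply: sub; exists f.
by rewrite E.
Qed.

Definition limsup_log_means S A eps : \bar R :=
  limf_esup (fun X => esup_or0 (log_means S eps X A)) (pinfty_nbhs R).

Lemma limsup_log_means_le S S' eps eps' A A' :
  S `<=` S' -> eps <= eps' -> A' <= A ->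
  (limsup_log_means S A eps <= limsup_log_means S' A' eps')%E.
Proof.
move=> SS ee AA; rewrite /limsup_log_means /limf_esup.
apply: le_ereal_inf_tmp => _ [V VF <-].
(* The pointwise comparison requires [1 <= X]. *)
pose V' := V `&` [set X | 1 <= X].
have V'F : pinfty_nbhs R V'.
  case: VF => M [Mr MV]; exists (Num.max M 1); split; first exact: num_real.
  by move=> x; rewrite gt_max => /andP[Mx /ltW x1]; split; [exact: MV | exact: x1].
apply: ge_ereal_inf; eexists; first by exists V'; [exact: V'F | reflexivity].
apply: ge_ereal_sup => _ [X [VX X1] <-].
apply: le_trans (esup_or0_log_means_le X1 SS ee AA) _.
by apply: ereal_sup_ubound; exists X.
Qed.

Lemma limsup_log_means_ge S A eps (v : R) :
  (forall M eta : R, 0 < eta -> exists X (f : nat -> R[i]),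
     [/\ M < X, mult_class S f, small_means eps X A f & v - eta <= log_mean f X]) ->
  (v%:E <= limsup_log_means S A eps)%E.
Proof.
move=> H; apply: le_ereal_inf_tmp => _ [V [M [_ MV]] <-].
apply/lee_subgt0Pr => eta eta0; have [X [f [MX fS fe fv]]] := H M eta eta0.
apply: (@le_trans _ _ (esup_or0 (log_means S eps X A))); last first.
  by apply: ereal_sup_ubound; exists X => //; exact: MV.
have fin : log_means S eps X A (log_mean f X)%:E by exists f.
rewrite /esup_or0; case: eqP => [E|_]; first by move: fin; rewrite E.
apply: le_ereal_sup_tmp; exists (log_mean f X)%:E => //.
Qed.

Lemma is_cvg_gammaA S A : cvg (limsup_log_means S A eps @[eps --> 0^'+]).
Proof.
apply: nondecreasing_at_right_is_cvge; apply: nearW => x a b _ _ ab.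
exact: limsup_log_means_le.
Qed.

Lemma gammaA_le S S' A A' : S `<=` S' -> A' <= A -> (gammaA S A <= gammaA S' A')%E.
Proof.
move=> SS AA; apply: lee_lim; [exact: is_cvg_gammaA | exact: is_cvg_gammaA |].
by apply: nearW => e; exact: limsup_log_means_le.
Qed.

Lemma is_cvg_gamma S : cvg (gammaA S A @[A --> +oo]).
Proof.
apply/cvg_ex; eexists; apply: nonincreasing_cvge => a b ab.
exact: gammaA_le.
Qed.

Lemma gamma_le S S' : S `<=` S' -> (gamma S <= gamma S')%E.
Proof.
move=> SS; apply: lee_lim; [exact: is_cvg_gamma | exact: is_cvg_gamma |].
by apply: nearW => A; exact: gammaA_le.
Qed.

(** Both outer limits preserve lower bounds, and the innermost limsup asks only for arbitrarily
    large [X]. *)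
Lemma gamma_ge S (v : R) :
  (forall A eps M eta : R, 1 <= A -> 0 < eps -> 0 < eta ->
     exists X (f : nat -> R[i]),
     [/\ M < X, mult_class S f, small_means eps X A f & v - eta <= log_mean f X]) ->
  (v%:E <= gamma S)%E.
Proof.
move=> H; apply: lime_ge; first exact: is_cvg_gamma.
near=> A; apply: lime_ge; first exact: is_cvg_gammaA.
near=> eps; apply: limsup_log_means_ge => M eta eta0; apply: H => //.
Unshelve. all: by end_near. Qed.

End Gamma.

(** * Lower bounds for gamma *)

Section LowerBound.
Variable R : realType.
Local Notation C := R[i].
Local Notation cmod := (@ComplexField.Normc.normc R).
Local Notation lnn n := (ln (n%:R : R)).
Implicit Types (c sg : R) (y X B N : nat).

(** [ln 20 - ln 10] is at least the sum of [1/n] over [11 <= n <= 20], about [0.6688]. The bound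
    gives [u < 2] down to [c = 3/2]. *)
Lemma ln2_gt_two_thirds : 2 / 3 < ln 2 :> R.
Proof.
have l20 : lnn 20 = ln 2 + lnn 10.
  by rewrite -lnM ?posrE // -natrM.
have s n := @ln_succ_ge R n.
move: (s 10%N isT) (s 11%N isT) (s 12%N isT) (s 13%N isT) (s 14%N isT) (s 15%N isT)
  (s 16%N isT) (s 17%N isT) (s 18%N isT) (s 19%N isT).
move: l20; move: (ln 2) (lnn 10) (lnn 11) (lnn 12) (lnn 13) (lnn 14) (lnn 15)
  (lnn 16) (lnn 17) (lnn 18) (lnn 19) (lnn 20).
by move=> *; lra.
Qed.

Lemma ex_exponent_cutoff c y : 3 / 2 <= c <= 2 -> 21 <= lnn y ->
  exists X, [/\ (y < X < y * y)%N, expR c^-1 * lnn y - 1 <= lnn X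
              & lnn X <= expR c^-1 * lnn y].
Proof.
move=> /andP[c1 c2] y21; have c0 : 0 < c by lra.
set u := expR c^-1.
have y1 : (1 < y)%N.
  rewrite ltnNge; apply/negP => y1.
  have : lnn y <= 0 by apply: ln_le0; rewrite lern1.
  by move: y21; lra.
have y0 : 0 < y%:R :> R by rewrite ltr0n ltnW.
have u32 : 3 / 2 <= u.
  have : 2^-1 <= c^-1 by rewrite lef_pV2 ?posrE.
  by have := expR_ge1Dx c^-1; rewrite -/u; lra.
have u2 : u < 2.
  have -> : 2 = expR (ln 2) :> R by rewrite lnK ?posrE.
  rewrite ltr_expR; apply: le_lt_trans ln2_gt_two_thirds.
  by rewrite -[2 / 3]invf_div lef_pV2 ?posrE // divr_gt0.
(* [X] is the integer part of [Y = y^u]. Rounding loses a factor at most [2 <= e], hence the [- 1]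
   in the statement, and [Y >= 2 y] keeps [X] above [y]. *)
pose Y : R := expR (u * lnn y).
have Y0 : 0 <= Y by exact: expR_ge0.
have /andP[XY YX] := truncn_itv Y0.
exists (Num.truncn Y); set X := Num.truncn Y in XY YX *.
have Y2y : 2 * y%:R <= Y.
  rewrite -[y%:R]lnK ?posrE // -[2]lnK ?posrE // -expRD ler_expR.
  have : ln 2 <= 1 :> R by have := @ln_le_subr1 R 2; lra.
  have : 3 / 2 * lnn y <= u * lnn y by rewrite ler_wpM2r //; move: y21; lra.
  by move: y21; lra.
have yX : (y < X)%N.
  rewrite -ltnS -(ltr_nat R); apply: le_lt_trans YX; apply: le_trans Y2y.
  by rewrite -natrM ler_nat mul2n -addnn -addn1 leq_add2l ltnW.
have X0 : (0 < X)%N by exact: leq_trans yX.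
have X0' : 0 < X%:R :> R by rewrite ltr0n.
split.
- rewrite yX /= -(ltr_nat R); apply: le_lt_trans XY _.
  rewrite natrM -[y%:R]lnK ?posrE // -expRD ltr_expR.
  have : u * lnn y < 2 * lnn y by rewrite ltr_pM2r //; move: y21; lra.
  by rewrite -(expRK (lnn y)) !lnK ?posrE //; lra.
- have : Y <= expR 1 * X%:R.
    apply: le_trans (ltW YX) _; apply: (@le_trans _ _ (2 * X%:R)).
      by rewrite -natrM ler_nat mul2n -addnn -addn1 leq_add2l.
    by rewrite ler_wpM2r //; have := expR_ge1Dx (1 : R); lra.
  rewrite -ler_ln ?posrE ?expR_gt0 ?mulr_gt0 ?expR_gt0 //.
  by rewrite lnM ?posrE ?expR_gt0 // /Y !expRK; lra.
- by rewrite -[X in _ <= X]expRK ler_ln ?posrE ?expR_gt0.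
Qed.

Lemma ex_extremal_function c sg y B : 3 / 2 <= c <= 2 ->
  (1 - c) ^+ 2 + sg ^+ 2 = 1 -> 21 <= lnn y ->
  exists X (f : nat -> C),
  [/\ (y < X < y * y)%N, completely_multiplicative f,
      forall p, prime p -> [\/ f p = 1, f p = Complex (1 - c) sg
                             | f p = Complex (1 - c) (- sg)],
      forall N, (X <= N <= y ^ B)%N -> cmod (\sum_(1 <= n < N.+1) f n) <=
        (95 + 44 * (B%:R + 4)) * (1 + 4 * (B%:R + 4)) ^+ B / lnn y * N%:R
    & c * (1 - expR (- c^-1)) - 62 / lnn y <=
        (lnn X)^-1 * cmod (\sum_(1 <= n < X.+1) f n / n%:R)].
Proof.
move=> c32 c_sg y21; have [X [yX X1 X2]] := ex_exponent_cutoff c32 y21.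
have /andP[c1 c2] := c32; have c0 : 0 < c by lra.
have c12 : 1 <= c <= 2 by rewrite c2 andbT; lra.
set u := expR c^-1 in X1 X2.
have u0 : 0 < u by exact: expR_gt0.
have u32 : 3 / 2 <= u.
  have : 2^-1 <= c^-1 by rewrite lef_pV2 ?posrE.
  by have := expR_ge1Dx c^-1; rewrite -/u; lra.
have ly0 : 0 < lnn y by lra.
have /andP[yX' Xyy] := yX.
have y1 : (1 < y)%N.
  rewrite ltnNge; apply/negP => y1.
  have : lnn y <= 0 by apply: ln_le0; rewrite lern1.
  by lra.
have lX : lnn y < lnn X by rewrite ltr_ln_nat // ltnW.
have lX0 : 0 < lnn X by lra.
pose W := \sum_(y.+1 <= q < X.+1) prime_inv R q.
(* This is what [u = exp (1/c)] is for: [ln (ln X / ln y)] is about [1/c]. Mertens contributes [9]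
   and the rounding of [X] contributes [1]. *)
have W_c : `|W - c^-1| <= 10 / lnn y.
  have yX1 : (1 < y <= X)%N by rewrite y1 ltnW.
  have := mertens_second R yX1; rewrite -/W.
  have H1 : ln (lnn X) <= ln (lnn y) + c^-1.
    rewrite -[c^-1]expRK -/u -lnM ?posrE // ler_ln ?posrE ?mulr_gt0 //.
    by rewrite mulrC.
  have H2 : ln (lnn y) + c^-1 - ln (lnn X) <= (lnn y)^-1.
    rewrite -[c^-1]expRK -/u -lnM ?posrE // -ln_div ?posrE ?mulr_gt0 //.
    apply: le_trans (ln_le_subr1 _) _; first by rewrite divr_gt0 ?mulr_gt0.
    have -> : lnn y * u / lnn X - 1 = (u * lnn y - lnn X) / lnn X.
      by field; rewrite gt_eqF.
    apply: (@le_trans _ _ (1 / lnn X)).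
      by rewrite ler_pM2r ?invr_gt0 //; lra.
    by rewrite mul1r lef_pV2 ?posrE // ltW.
  rewrite !ler_norml; move: H1 H2; move: (lnn y)^-1 (ln (lnn X)) (ln (lnn y)) => a b d.
  by lra.
have W0 : 0 < W.
  have : 2^-1 <= c^-1 by rewrite lef_pV2 ?posrE.
  have : (lnn y)^-1 <= 21^-1 by rewrite lef_pV2 ?posrE.
  by move: W_c; rewrite ler_norml; move: ((lnn y)^-1) => a; lra.
have [e [e_small e_middle t_greedy]] := @ex_greedy_selection R y X y1 yX W0.
have a01 n : 0 <= (e n)%:R * prime_weight R n <= 1.
  have := prime_weight_ge0 R n; have := prime_weight_le1 R n.
  by case: (e n); rewrite ?mul1r ?mul0r ?lexx ?ler01 // => -> ->.
have [s s_balanced] := ex_balancing_signs a01.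
have [g gE] := ex_dirichlet_quotient (extremal c sg e s).
exists X, (extremal c sg e s); split => //.
- exact: extremal_completely_multiplicative.
- move=> p pp; rewrite extremal_prime // /prime_value; case: (e p); last by constructor 1.
  case: (s p); first by rewrite expr1 mulN1r; constructor 3.
  by rewrite expr0 mul1r; constructor 2.
- move=> N XN.
  exact: (cmod_sum_extremal_le c12 c_sg y21 yX W_c e_small e_middle t_greedy s_balanced gE XN).
have F := cmod_log_sum_extremal_ge c12 y21 yX W_c e_small e_middle gE.
rewrite [X in _ <= X]mulrC ler_pdivlMr //; apply: le_trans F.
rewrite expRN -/u.
have E : lnn X * u^-1 <= lnn y by rewrite ler_pdivrMr // mulrC.
(* The rounding of [X] costs at most [c <= 2] times [ln X / ln y], which turns [60] into [62]. *)
have E' : lnn y <= lnn X * u^-1 + lnn X / lnn y.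
  have E1 : lnn y - u^-1 <= lnn X * u^-1.
    rewrite -[X in X - _](mulfK (negbT (gt_eqF u0))) -[X in _ - X]mul1r -mulrBl.
    by rewrite ler_pM2r ?invr_gt0 // mulrC.
  have E2 : u^-1 <= 1 by rewrite invf_le1 //; lra.
  have E3 : 1 <= lnn X / lnn y by rewrite ler_pdivlMr // mul1r ltW.
  by move: E1 E2 E3; move: (lnn X * u^-1) (lnn X / lnn y) u^-1 => a b d; lra.
have E3 : 1 <= lnn X / lnn y by rewrite ler_pdivlMr // mul1r ltW.
have cE' := ler_wpM2l (ltW c0) E'.
have cE3 : c * (lnn X / lnn y) <= 2 * (lnn X / lnn y).
  by rewrite ler_wpM2r // divr_ge0 // ltW.
have -> : (c * (1 - u^-1) - 62 / lnn y) * lnn X =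
    c * lnn X - c * (lnn X * u^-1) - 62 * (lnn X / lnn y) by ring.
by move: cE' cE3 E3; move: (lnn X * u^-1) (lnn X / lnn y) => a b; lra.
Qed.

Lemma gamma_lower_bound (S : set C) c sg : 3 / 2 <= c <= 2 ->
  (1 - c) ^+ 2 + sg ^+ 2 = 1 ->
  S 1 -> S (Complex (1 - c) sg) -> S (Complex (1 - c) (- sg)) ->
  ((c * (1 - expR (- c^-1)))%:E <= gamma S)%E.
Proof.
move=> c32 c_sg S1 S2 S3; apply: gamma_ge => A eps M eta A1 eps0 eta0.
(* Since [X < y^2], this gives [X^A <= y^B]. *)
pose B := (Num.truncn (2 * A)).+1.
pose K : R := (95 + 44 * (B%:R + 4)) * (1 + 4 * (B%:R + 4)) ^+ B.
(* With [B] fixed, [K] is a constant, so a large [ln y] makes [K / ln y <= eps] and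
   [62 / ln y <= eta], besides [X > M]. *)
pose L : R := Num.max (Num.max 21 M) (Num.max (K / eps) (62 / eta)).
pose y := (Num.truncn (expR L)).+1.
have Ly : L <= lnn y.
  rewrite -[L]expRK ler_ln ?posrE ?expR_gt0 ?ltr0n //.
  exact/ltW/truncnS_gt.
have : L <= lnn y by [].
rewrite {1}/L !ge_max => /andP[/andP[y21 yM] /andP[yK yeta]].
have ly0 : 0 < lnn y by lra.
have [X [f [yX fM fp fS fL]]] := @ex_extremal_function c sg y B c32 c_sg y21.
have /andP[yX' Xyy] := yX.
have X0 : (0 < X)%N by exact: leq_trans yX'.
exists X%:R, f; split.
- apply: le_lt_trans yM _; apply: le_lt_trans (ln_nat_le R y) _.
  by rewrite ltr_nat.
- split=> // p pp.
  by case: (fp p pp) => ->.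
- move=> x Xx xXA; rewrite /sum_upto.
  have x0 : 0 < x by apply: lt_le_trans Xx; rewrite ltr0n.
  have /andP[Nx xN] := truncn_itv (ltW x0); set N := Num.truncn x in Nx xN *.
  have XN : (X <= N)%N by rewrite -ltnS -(ltr_nat R) (le_lt_trans Xx).
  have N0 : (0 < N)%N by exact: leq_trans XN.
  have NB : (N <= y ^ B)%N.
    rewrite -(ler_nat R) natrX -ler_ln ?posrE ?exprn_gt0 ?ltr0n // lnXn ?ltr0n //.
    have lN : lnn N <= A * lnn X.
      rewrite -ln_powR ler_ln ?posrE ?powR_gt0 ?ltr0n //.
      exact: le_trans Nx xXA.
    have lX : lnn X <= 2 * lnn y.
      apply: le_trans (ler_ln_nat R X0 (ltnW Xyy)) _.
      have y0 : 0 < y%:R :> R by rewrite ltr0n.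
      by rewrite natrM lnM ?posrE //; lra.
    have AB : 2 * A <= B%:R by exact/ltW/truncnS_gt.
    rewrite -[lnn y *+ B]mulr_natl; apply: le_trans lN _.
    apply: (@le_trans _ _ (A * (2 * lnn y))); first by rewrite ler_wpM2l //; lra.
    by rewrite mulrA [A * 2]mulrC ler_wpM2r // ltW.
  have XNB : (X <= N <= y ^ B)%N by rewrite XN.
  apply: le_trans (fS N XNB) _; rewrite -/K; apply: ler_pM => //.
    rewrite divr_ge0 ?(ltW ly0) // /K mulr_ge0 ?exprn_ge0 ?addr_ge0 ?mulr_ge0 ?addr_ge0 //.
  by rewrite ler_pdivrMr // mulrC -ler_pdivrMr.
- rewrite /log_mean /sum_upto natrK; apply: le_trans fL; rewrite lerD2l lerN2.
  by rewrite ler_pdivrMr // mulrC -ler_pdivrMr.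
Qed.

Lemma expr_cis (a : R) n :
  Complex (cos a) (sin a) ^+ n = Complex (cos (n%:R * a)) (sin (n%:R * a)).
Proof.
elim: n => [|n IH]; first by rewrite expr0 mul0r cos0 sin0.
rewrite exprS IH -natr1 mulrDl mul1r cosD sinD.
by apply/eqP; rewrite eq_complex /=; apply/andP; split; apply/eqP; ring.
Qed.

Lemma expr_odd_neg_cis (a : R) k : odd k -> k%:R * a = pi \/ k%:R * a = - pi ->
  (- Complex (cos a) (sin a)) ^+ k = 1.
Proof.
move=> ok H; rewrite exprNn expr_cis -signr_odd ok expr1.
have -> : Complex (cos (k%:R * a)) (sin (k%:R * a)) = - 1 :> C.
  by apply/eqP; rewrite eq_complex /=; case: H => ->;
    rewrite ?cosN ?sinN cospi sinpi ?oppr0 !eqxx.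
by rewrite mulrNN mulr1.
Qed.

(** The angle [2 pi / 3] is both the double and the supplement of [pi / 3], so the cosine is the
    positive root of [(2x - 1)(x + 1)]. *)
Lemma cos_pi_third : cos (pi / 3) = 1 / 2 :> R.
Proof.
have p0 := pi_gt0 R.
have c0 : 0 < cos (pi / 3) :> R by apply: cos_gt0_pihalf; lra.
have : cos ((pi / 3) *+ 2) = - cos (pi / 3) :> R.
  have -> : (pi / 3) *+ 2 = - (pi / 3) + pi :> R by lra.
  by rewrite cosDpi cosN.
rewrite cos_mulr2n => H.
have : (2 * cos (pi / 3) - 1) * (cos (pi / 3) + 1) = 0 :> R.
  by move: H; move: (cos _) => x; lra.
by move/eqP; rewrite mulf_eq0 => /orP[/eqP|/eqP]; lra.
Qed.

Lemma cos_pi_div_ge_half k : (3 <= k)%N -> 1 / 2 <= cos (pi / k%:R) :> R.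
Proof.
move=> k3; have p0 := pi_gt0 R; rewrite -cos_pi_third leNgt.
have k0 : 0 < k%:R :> R by rewrite ltr0n (leq_trans _ k3).
have pk : pi / k%:R <= pi / 3 :> R.
  by rewrite ler_pM2l // lef_pV2 ?posrE // ler_nat.
have pk0 : 0 < pi / k%:R :> R by rewrite divr_gt0.
rewrite ltr_cos ?in_itv /=; first by rewrite -leNgt.
  by lra.
by rewrite (ltW pk0) /=; lra.
Qed.

End LowerBound.

Theorem mainTheorem3 (R : realType) :
  (forall k : nat, (1 <= k)%N ->
     [/\ (gamma (unit_disc R) >= gamma (roots0 R (2 * k)))%E,
         (gamma (roots0 R (2 * k)) >= gamma (roots0 R 2))%E
       & (gamma (roots0 R 2) >= (2 - 2 / Num.sqrt (expR 1))%:E)%E]) /\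
  (forall k : nat, (3 <= k)%N -> odd k ->
     (gamma (roots0 R k) >=
        ((1 + delta R k) * (1 - expR (- (1 / (1 + delta R k)))))%:E)%E).
Proof.
split=> k k0; first split.
- apply: gamma_le => z [->|/= zk]; rewrite /unit_disc /mkset.
    by rewrite cmod0.
  have cX n : ComplexField.Normc.normc (z ^+ n) = ComplexField.Normc.normc z ^+ n.
    by elim: n => [|n IH]; rewrite ?expr0 ?cmod1 // !exprS cmodM IH.
  have := cX (2 * k)%N; rewrite zk cmod1 => /esym/eqP.
  by rewrite pexpr_eq1 ?cmod_ge0 ?muln_gt0 // => /eqP ->.
- apply: gamma_le => z [->|/= z2]; [by left | right].
  by rewrite /= exprM z2 expr1n.
- have -> : 2 - 2 / Num.sqrt (expR 1) = 2 * (1 - expR (- 2^-1)) :> R.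
    have -> : expR 1 = expR 2^-1 ^+ 2 :> R by rewrite -expRM_natl; congr expR; lra.
    by rewrite sqrtr_sqr ger0_norm ?expR_ge0 // expRN; ring.
  (* Here xi is [-1], its own conjugate. *)
  apply: (@gamma_lower_bound R _ 2 0); [by lra | by ring | by right; rewrite /= expr1n |..].
  1-2: by right; apply/eqP; rewrite eq_complex /=; apply/andP; split; apply/eqP; ring.
- move=> ok; have kn0 : k%:R != 0 :> R by rewrite pnatr_eq0 -lt0n (leq_trans _ k0).
  have kpi : k%:R * (pi / k%:R) = pi :> R by rewrite mulrCA divff ?mulr1.
  (* The two values are [- exp (- i pi/k)] and [- exp (i pi/k)]. They are [k]-th roots of unity
     because [k] is odd: the sign and the exponential both have [k]-th power [-1]. *)
  rewrite div1r /delta; apply: (@gamma_lower_bound R _ _ (sin (pi / k%:R))).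
  + by have := cos_pi_div_ge_half R k0; have := cos_le1 (pi / k%:R : R); lra.
  + by rewrite opprD addNKr sqrrN cos2Dsin2.
  + by right; rewrite /= expr1n.
  + right; rewrite /= -(@expr_odd_neg_cis R (- (pi / k%:R)) k ok); last first.
      by right; rewrite mulrN kpi.
    congr (_ ^+ _); rewrite cosN sinN; apply/eqP; rewrite eq_complex /=.
    by apply/andP; split; apply/eqP; ring.
  + right; rewrite /= -(@expr_odd_neg_cis R (pi / k%:R) k ok); last by left.
    congr (_ ^+ _); apply/eqP; rewrite eq_complex /=.
    by apply/andP; split; apply/eqP; ring.
Qed.
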